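(* Let $k$ be a positive integer, let $\epsilon > 0$, let $G$ be a finite abelian group and let $A_1,\dots,A_k \subseteq G$. Then there is a pair $(R,\eta)$, where $R$ is a set of characters of $G$ with $d = |R| \leq W(2^{11}k^2\epsilon^{-3})$ and $\eta \in (0,1]$ satisfies $\eta \geq 1/W(2^{11}k^2\epsilon^{-3})$, such that $(R,\eta)$ is $\epsilon$-regular for each of $A_1,\dots,A_k$ (with respect to the parameters $k,\epsilon$).
   Context: $G$ is a finite abelian group, $N = |G|$, $G^{\ast}$ is its group of characters $\gamma : G \to \mathbb{C}$. For $f : G \to \mathbb{R}$, $\widehat{f}(\gamma) = \sum_x f(x)\gamma(x)$; convolution is $f \ast g(x) = \sum_y f(y)g(x-y)$. A set is identified with its indicator function. The argument of a nonzero complex number is taken in $(-\pi,\pi]$. For a finite set of characters $\Gamma = \{\gamma_1,\dots,\gamma_d\}$ and $x \in G$ put $\|x\|_{\Gamma} = \max_j |\arg \gamma_j(x)|/(2\pi)$ (and $\|x\|_{\emptyset} = 0$), and for $t \ge 0$ let $B_{\Gamma,t} = \{x : \|x\|_\Gamma \leq t\}$. For $\delta > 0$ define $\widetilde{B}_{\Gamma,\delta}(x) = \int_0^\infty B_{\Gamma,t}(x)\, \delta^{-1}e^{-t/\delta}\,dt$, $\beta_{\Gamma,\delta} = \widetilde{B}_{\Gamma,\delta}/\sum_y \widetilde{B}_{\Gamma,\delta}(y)$, and $\psi_{\Gamma,\delta} = \beta_{\Gamma,\delta} \ast \beta_{\Gamma,\delta}$. Given $k$, $\epsilon$ and a pair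 $(R,\eta)$ with $R \subseteq G^{\ast}$, $d = |R|$, $\eta \in (0,1]$, set $\psi_1 = \psi_{R,\eta}$ and $\psi_2 = \psi_{R,\eta_2}$ with $\eta_2 = 2^{-40}\epsilon^6\eta/(dk^4)$ (if $d = 0$ then $\psi_{\emptyset,\delta} \equiv 1/N$ for every $\delta$, so the value of $\eta_2$ is immaterial). For $A \subseteq G$ and $x \in G$ write $\alpha_j^x = (A \ast \psi_j)(x)$ for $j = 1,2$. A point $x \in G$ is an $\epsilon$-regular value with respect to $A$ and $(R,\eta)$ if (i) $\sum_y (\alpha_2^{x+y} - \alpha_1^x)^2\psi_1(y) \leq \epsilon^2$, and (ii) for every $\gamma \in G^{\ast}$, $\left|\sum_n (A(x+n) - \alpha_2^x)\psi_2(n)\gamma(n)\right| \leq \epsilon$. The pair $(R,\eta)$ is $\epsilon$-regular for $A$ if fewer than $\epsilon N$ elements $x \in G$ fail to be $\epsilon$-regular values with respect to $A$. $W(t)$ denotes a tower of twos of height $\lceil t \rceil$ (i.e. $W(t) = w_{\lceil t\rceil}$ where $w_0 = 1$, $w_{h+1} = 2^{w_h}$). *)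

(* Defs.v *)
From mathcomp Require Import all_boot all_order all_algebra.
From mathcomp Require Import all_classical all_reals all_analysis.
From mathcomp Require Import complex.

Set Implicit Arguments.
Unset Strict Implicit.
Unset Printing Implicit Defensive.

Import Order.TTheory GRing.Theory Num.Theory.
Import numFieldNormedType.Exports.
Local Open Scope ring_scope.

Section Defs.
Variable R : realType.
Variable G : finZmodType.

Local Notation C := (R[i]).

Definition cmod (z : C) : R := Num.sqrt (complex.Re z ^+ 2 + complex.Im z ^+ 2).

(* principal argument in (-pi, pi] (for z <> 0) *)
Definition carg (z : C) : R :=
  if 0 <= complex.Im z then acos (complex.Re z / cmod z) else - acos (complex.Re z / cmod z).

Definition is_character (g : {ffun G -> C}) : Prop :=
  g 0 = 1 /\ forall x y : G, g (x + y) = g x * g y.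

Definition gnorm (Gam : seq {ffun G -> C}) (x : G) : R :=
  \big[Num.max/0]_(g <- Gam) (`|carg (g x)| / (2 * pi)).

Definition Bset (Gam : seq {ffun G -> C}) (t : R) (x : G) : R :=
  ((gnorm Gam x <= t)%R : bool)%:R.

Definition Btilde (Gam : seq {ffun G -> C}) (delta : R) (x : G) : R :=
  (\int[@lebesgue_measure R]_(t in `[0, +oo[%classic)
      (Bset Gam t x * delta^-1 * expR (- (t / delta))))%R.

Definition beta (Gam : seq {ffun G -> C}) (delta : R) (x : G) : R :=
  Btilde Gam delta x / \sum_(y : G) Btilde Gam delta y.

Definition conv (f g : G -> R) (x : G) : R := \sum_(y : G) f y * g (x - y).

Definition psi (Gam : seq {ffun G -> C}) (delta : R) : G -> R :=
  conv (beta Gam delta) (beta Gam delta).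

(* eta_2 = 2^-40 eps^6 eta / (d k^4); for d = 0 the value is immaterial
   (psi_{emptyset, delta} = 1/N for every delta > 0), we take eta. *)
Definition eta2 (k : nat) (eps : R) (Rs : seq {ffun G -> C}) (eta : R) : R :=
  if size Rs == 0%N then eta
  else 2 ^- 40 * eps ^+ 6 * eta / ((size Rs)%:R * k%:R ^+ 4).

Definition psi1 (Rs : seq {ffun G -> C}) (eta : R) : G -> R := psi Rs eta.
Definition psi2 k eps (Rs : seq {ffun G -> C}) (eta : R) : G -> R :=
  psi Rs (eta2 k eps Rs eta).

Definition indic (A : {set G}) (x : G) : R := (x \in A)%:R.

Definition alpha1 (A : {set G}) Rs eta (x : G) : R := conv (indic A) (psi1 Rs eta) x.
Definition alpha2 k eps (A : {set G}) Rs eta (x : G) : R :=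
  conv (indic A) (psi2 k eps Rs eta) x.

Definition regular_value (k : nat) (eps : R) (A : {set G})
    (Rs : seq {ffun G -> C}) (eta : R) (x : G) : Prop :=
  (\sum_(y : G) (alpha2 k eps A Rs eta (x + y) - alpha1 A Rs eta x) ^+ 2
      * psi1 Rs eta y <= eps ^+ 2)
  /\ (forall g : {ffun G -> C}, is_character g ->
        cmod (\sum_(n : G) ((indic A (x + n) - alpha2 k eps A Rs eta x)
                             * psi2 k eps Rs eta n)%:C%C * g n) <= eps).

Definition regular_pair (k : nat) (eps : R) (A : {set G})
    (Rs : seq {ffun G -> C}) (eta : R) : Prop :=
  (#|[set x : G | ~~ `[< regular_value k eps A Rs eta x >]]|%:R
     < eps * #|G|%:R).

End Defs.

Fixpoint tower (h : nat) : nat :=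
  match h with 0 => 1 | h'.+1 => 2 ^ tower h' end.

(* W(t) = w_{ceil t}  (used for t > 0) *)
Definition W (R : realType) (t : R) : R := (tower `|Num.ceil t|%N)%:R.

(* Main.v *)
(** Iterate an energy increment, the energy of [(R, eta)] being the sum over the
    sets [A] and over [x] of [((A * psi_{R,eta}) x)^2], which is at most [k N].
    The kernel [Btilde] equals [exp (- |x| / delta)], so [psi] is Lipschitz in
    [L1], and doubling of Bohr sets bounds the [psi]-mean of the norm by
    [48 d delta]; hence a narrower kernel leaves a wider one essentially
    unchanged under convolution.  Expanding a square then shows that any variance
    of [A * psi_narrow] around [A * psi_wide] appears as an energy increment.
    If (i) fails often, pass to [(R, eta2)].  If (ii) fails often, cut [G] into
    cells on which all arguments of [R] are almost constant, add to [R] one bad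
    character per cell, and shrink the radius: the large Fourier coefficients
    turn into variance by Cauchy-Schwarz.  Each step gains [eps^3 N / 16] and
    costs at most five exponentials, and there are at most [16 k / eps^3 + 1]
    steps. *)

From mathcomp Require Import all_boot all_order all_algebra.
From mathcomp Require Import all_classical all_reals all_analysis.
From mathcomp Require Import complex ring lra zify.
(* Loaded last: mathcomp's monoid library also has a [gnorm]. *)
Require Import Defs.

Set Implicit Arguments.
Unset Strict Implicit.
Unset Printing Implicit Defensive.

Import Order.TTheory GRing.Theory Num.Theory.
Import numFieldNormedType.Exports.
Local Open Scope ring_scope.

(** * Modulus and argument of characters *)

Section Modulus.
Variable R : realType.
Implicit Types z w : R[i].

Lemma cmodE z : `|z| = (cmod z)%:C%C.
Proof. exact: normc_def. Qed.

Lemma cmod_ge0 z : 0 <= cmod z.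
Proof. exact: sqrtr_ge0. Qed.

Lemma cmodM z w : cmod (z * w) = cmod z * cmod w.
Proof.
by apply: (@complexI R); rewrite rmorphM/= -!cmodE normrM.
Qed.

Lemma cmod1 : cmod (1 : R[i]) = 1.
Proof. by apply: (@complexI R); rewrite -cmodE normr1. Qed.

Lemma cmod_real (a : R) : cmod (a%:C%C) = `|a|.
Proof. by rewrite /cmod /= expr0n /= addr0 sqrtr_sqr. Qed.

Lemma cmodD z w : cmod (z + w) <= cmod z + cmod w.
Proof. by rewrite -lecR rmorphD/= -!cmodE ler_normD. Qed.

Lemma cmodN z : cmod (- z) = cmod z.
Proof. by apply: (@complexI R); rewrite -!cmodE normrN. Qed.

Lemma cmodB_ge z w : cmod z - cmod w <= cmod (z - w).
Proof. by rewrite lerBlDr; apply: le_trans (cmodD _ _); rewrite subrK. Qed.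

Lemma cmod_sum (I : finType) (F : I -> R[i]) :
  cmod (\sum_i F i) <= \sum_i cmod (F i).
Proof.
rewrite -lecR raddf_sum/= -cmodE; apply: le_trans (ler_norm_sum _ _ _) _.
by apply: ler_sum => i _; rewrite cmodE.
Qed.

Lemma cmodX z n : cmod (z ^+ n) = cmod z ^+ n.
Proof. by elim: n => [|n IH]; rewrite ?expr0 ?cmod1// !exprS cmodM IH. Qed.

Lemma ReIm_unimod z : cmod z = 1 -> complex.Re z ^+ 2 + complex.Im z ^+ 2 = 1.
Proof.
move=> h; have : cmod z ^+ 2 = 1 by rewrite h expr1n.
by rewrite sqr_sqrtr // addr_ge0 ?sqr_ge0.
Qed.

Lemma Re_unimod z : cmod z = 1 -> -1 <= complex.Re z <= 1.
Proof.
move=> /ReIm_unimod h; rewrite -ler_norml -(@ler_sqr _ _ 1) ?nnegrE ?normr_ge0//.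
by rewrite expr1n real_normK ?num_real // -h lerDl sqr_ge0.
Qed.

Lemma norm_carg z : cmod z = 1 -> `|carg z| = acos (complex.Re z).
Proof.
move=> h; rewrite /carg h divr1.
have := acos_ge0 (Re_unimod h).
by case: ifP => _ p; rewrite ?normrN ger0_norm.
Qed.

Lemma cos_carg z : cmod z = 1 -> cos (carg z) = complex.Re z.
Proof.
move=> h; rewrite /carg h divr1.
have p : cos (acos (complex.Re z)) = complex.Re z.
  by apply: acosK; rewrite in_itv/= Re_unimod.
by case: ifP => _; rewrite ?cosN.
Qed.

Lemma sin_carg z : cmod z = 1 -> sin (carg z) = complex.Im z.
Proof.
move=> h; rewrite /carg h divr1.
have p : sin (acos (complex.Re z)) = `|complex.Im z|.
  rewrite sin_acos ?Re_unimod// -(ReIm_unimod h) addrAC subrr add0r.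
  by rewrite sqrtr_sqr.
case: ifPn => q; rewrite ?sinN p; first by rewrite ger0_norm.
by rewrite ltr0_norm ?opprK// ltNge.
Qed.

(** Among all angles with a given cosine, [acos] picks one of least modulus. This lets the triangle
    inequality for arguments survive reduction modulo [2 * pi]. *)
Lemma acos_cos_le (t : R) : acos (cos t) <= `|t|.
Proof.
have -> : cos t = cos `|t| by case: (ger0P t) => // _; rewrite cosN.
have [h|h] := lerP `|t| pi.
  by rewrite cosK// in_itv/= normr_ge0.
by apply: le_trans (ltW h); rewrite acos_lepi// cos_geN1 cos_le1.
Qed.

Lemma norm_cargM z w : cmod z = 1 -> cmod w = 1 ->
  `|carg (z * w)| <= `|carg z + carg w|.
Proof.
move=> hz hw; rewrite norm_carg ?cmodM ?hz ?hw ?mulr1//.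
have -> : complex.Re (z * w) = cos (carg z + carg w).
  rewrite cosD !cos_carg// !sin_carg//.
  by case: z {hz} => a b; case: w {hw}.
exact: acos_cos_le.
Qed.

Lemma norm_carg_le_pi z : cmod z = 1 -> `|carg z| <= pi.
Proof. by move=> h; rewrite norm_carg// acos_lepi// Re_unimod. Qed.

(** On the unit circle the inverse is the conjugate, and the modulus of the argument depends on the
    real part only. *)
Lemma norm_cargJ z w : cmod z = 1 -> z * w = 1 -> `|carg w| = `|carg z|.
Proof.
move=> hz hzw.
have hw : cmod w = 1 by have := cmodM z w; rewrite hzw cmod1 hz mul1r.
rewrite !norm_carg//; congr acos.
move: z w hz hw hzw => [a b] [c d] /ReIm_unimod/= hz /ReIm_unimod/= hw [h1 h2].
have e : (a - c) ^+ 2 + (b + d) ^+ 2 = 0.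
  have -> : (a - c) ^+ 2 + (b + d) ^+ 2
    = (a ^+ 2 + b ^+ 2) + (c ^+ 2 + d ^+ 2) - 2 * (a * c - b * d) by ring.
  by rewrite hz hw h1; ring.
move/eqP: e; rewrite paddr_eq0 ?sqr_ge0// sqrf_eq0 subr_eq0 => /andP[/eqP-> _].
by [].
Qed.

Lemma norm_sin_le (t : R) : `|sin t| <= `|t|.
Proof.
wlog t0 : t / 0 <= t.
  move=> H; have [/H//|/ltW h] := lerP 0 t.
  by rewrite -normrN -sinN -(normrN t) H// oppr_ge0.
have [c _] : exists2 c, c \in `[0, t] & sin t - sin 0 = cos c * (t - 0).
  apply: MVT_segment => //.
  exact/continuous_subspaceT/continuous_sin.
rewrite sin0 !subr0 => ->; rewrite normrM ler_piMl// cos_max//.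
Qed.

Lemma norm_1Bcos_le (t : R) : `|cos t - 1| <= `|t|.
Proof.
wlog t0 : t / 0 <= t.
  move=> H; have [/H//|/ltW h] := lerP 0 t.
  by rewrite -cosN -(normrN t) H// oppr_ge0.
have [c _] : exists2 c, c \in `[0, t] & cos t - cos 0 = - sin c * (t - 0).
  apply: MVT_segment => //.
  exact/continuous_subspaceT/continuous_cos.
rewrite cos0 subr0 => ->; rewrite normrM ler_piMl// normrN sin_max//.
Qed.

Lemma cmodB1_le z : cmod z = 1 -> cmod (z - 1) <= 2 * `|carg z|.
Proof.
move=> h.
have -> : z - 1 = (cos (carg z) - 1)%:C%C + 'i%C * (sin (carg z))%:C%C.
  rewrite cos_carg// sin_carg//; case: z {h} => a b.
  by congr Complex => /=; ring.
apply: le_trans (cmodD _ _) _; rewrite cmodM !cmod_real mulr2n mulrDl !mul1r.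
apply: lerD; first exact: norm_1Bcos_le.
by rewrite /cmod /= expr0n add0r expr1n sqrtr1 mul1r norm_sin_le.
Qed.
End Modulus.

(** * Characters and the Bohr norm *)

Section Characters.
Variables (R : realType) (G : finZmodType).
Implicit Types (g : {ffun G -> R[i]}) (Gam : seq {ffun G -> R[i]}) (x y : G).

(** Translation by [x] permutes the factors of the product of all values of [g], so
    [g x ^+ #|G| = 1]. *)
Lemma character_unimod g x : is_character g -> cmod (g x) = 1.
Proof.
move=> [g0 gM].
have gN0 y : g y != 0.
  by apply/eqP => gy0; have /eqP := gM y (- y); rewrite subrr g0 gy0 mul0r oner_eq0.
have : \prod_y g (y + x) = \prod_y g y by rewrite [RHS](reindex_inj (addIr x)).
under eq_bigr do rewrite gM.
rewrite big_split/= prodr_const => /(canRL (mulKf _)) gX.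
have {gX} gX : g x ^+ #|G| = 1 by rewrite gX ?mulVf//; apply/prodf_neq0.
have : cmod (g x) ^+ #|G| = 1 by rewrite -cmodX gX cmod1.
have G0 : (0 < #|G|)%N by apply/card_gt0P; exists 0.
by move=> /eqP; rewrite pexpr_eq1 ?cmod_ge0// => /eqP.
Qed.

Lemma pi_le4 : pi <= 4 :> R.
Proof. by have [/andP[_ h] _] := @pihalf_02_cos_pihalf R; lra. Qed.

Definition chars Gam := forall g, g \in Gam -> is_character g.

Definition argn g x : R := `|carg (g x)| / (2 * pi).

Lemma twopi_gt0 : 0 < 2 * pi :> R.
Proof. by rewrite mulr_gt0 ?pi_gt0. Qed.

Lemma gnorm_ge0 Gam x : 0 <= gnorm Gam x.
Proof. exact: bigmax_ge_id. Qed.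

Lemma argn_le_gnorm Gam g x : g \in Gam -> argn g x <= gnorm Gam x.
Proof. by move=> gG; apply: (le_bigmax_seq 0 g xpredT (fun g => argn g x)). Qed.

Lemma gnorm_le Gam x t :
  0 <= t -> (forall g, g \in Gam -> argn g x <= t) -> gnorm Gam x <= t.
Proof.
move=> t0 h; rewrite /gnorm big_seq; apply: bigmax_le => //; exact: h.
Qed.

Lemma gnorm_nil x : gnorm [::] x = 0 :> R.
Proof. by rewrite /gnorm big_nil. Qed.

Lemma gnorm_sub Gam Gam' x : {subset Gam <= Gam'} -> gnorm Gam x <= gnorm Gam' x.
Proof.
move=> h; apply: gnorm_le => [|g gG]; first exact: gnorm_ge0.
by apply: argn_le_gnorm; apply: h.
Qed.

Lemma gnormN Gam x : chars Gam -> gnorm Gam (- x) = gnorm Gam x.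
Proof.
move=> cG; rewrite /gnorm !big_seq; apply: eq_bigr => g gG; congr (_ / _).
have [g0 gM] := cG _ gG; apply: norm_cargJ; first exact: character_unimod (cG _ gG).
by rewrite -gM subrr.
Qed.

Lemma gnormD Gam x y : chars Gam -> gnorm Gam (x + y) <= gnorm Gam x + gnorm Gam y.
Proof.
move=> cG; apply: gnorm_le => [|g gG]; first by rewrite addr_ge0 ?gnorm_ge0.
apply: le_trans (lerD (argn_le_gnorm x gG) (argn_le_gnorm y gG)).
rewrite /argn -mulrDl ler_pM2r ?invr_gt0 ?twopi_gt0//.
have cg := cG _ gG; have [_ ->] := cg.
apply: le_trans (norm_cargM _ _) (ler_normD _ _); exact: character_unimod.
Qed.

(** The hypothesis compares the principal arguments as plain real numbers, which is what sorting
    them into intervals provides. *)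
Lemma gnormB_le Gam x y t : chars Gam -> 0 <= t ->
  (forall g, g \in Gam -> `|carg (g x) - carg (g y)| <= t * (2 * pi)) ->
  gnorm Gam (x - y) <= t.
Proof.
move=> cG t0 h; apply: gnorm_le => // g gG.
rewrite /argn ler_pdivrMr ?twopi_gt0//; apply: le_trans (h _ gG).
have cg := cG _ gG; have [g0 gM] := cg.
have ux := character_unimod x cg; have uy := character_unimod y cg.
have uNy := character_unimod (- y) cg.
have e : g y * g (- y) = 1 by rewrite -gM subrr.
rewrite gM norm_carg ?cmodM ?ux ?uNy ?mulr1//.
suff -> : complex.Re (g x * g (- y)) = cos (carg (g x) - carg (g y)).
  exact: acos_cos_le.
rewrite cosB !cos_carg// !sin_carg//.
move/ReIm_unimod: uy; move/ReIm_unimod: uNy; move: e.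
case: (g x) => a b; case: (g y) => c d; case: (g (- y)) => c' d' /= [e1 e2] h1 h2.
have ec : (c - c') ^+ 2 + (d + d') ^+ 2 = 0.
  have -> : (c - c') ^+ 2 + (d + d') ^+ 2
    = (c ^+ 2 + d ^+ 2) + (c' ^+ 2 + d' ^+ 2) - 2 * (c * c' - d * d') by ring.
  by rewrite h1 h2 e1; ring.
move/eqP: ec; rewrite paddr_eq0 ?sqr_ge0// !sqrf_eq0 subr_eq0 addr_eq0.
by move=> /andP[/eqP-> /eqP->]; ring.
Qed.

(** The chord is at most twice the argument, hence at most [4 * pi] times the norm; [pi <= 4] gives
    16. *)
Lemma cmod_characterB1 Gam g x : chars Gam -> g \in Gam ->
  cmod (g x - 1) <= 16 * gnorm Gam x.
Proof.
move=> cG gG; have u := character_unimod x (cG _ gG).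
apply: le_trans (cmodB1_le u) _.
have := argn_le_gnorm x gG; rewrite /argn ler_pdivrMr ?twopi_gt0//.
move=> h; have := pi_le4; have := gnorm_ge0 Gam x; have := normr_ge0 (carg (g x)).
by nra.
Qed.

End Characters.

(** * The exponentially weighted Bohr kernels *)

Section Kernel.
Variables (R : realType) (G : finZmodType).
Implicit Types (g : {ffun G -> R[i]}) (Gam : seq {ffun G -> R[i]}) (x y : G).

(** The indicator restricts the integral to [t] at least the norm of [x], where the integrand has
    antiderivative [- expR (- (t / delta))]. *)
Lemma BtildeE Gam (delta : R) x : 0 < delta ->
  Btilde Gam delta x = expR (- (gnorm Gam x / delta)).
Proof.
move=> d0; set a := gnorm Gam x.
have a0 : 0 <= a by exact: gnorm_ge0.
pose f t := delta^-1 * expR (- (t / delta)).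
have cE : continuous (fun t : R => expR (- (t / delta))).
  move=> t; apply: continuous_comp; last exact: continuous_expR.
  apply: (@continuousN _ R^o).
  by apply: continuousM => //; exact: cst_continuous.
rewrite /Btilde.
transitivity (\int[@lebesgue_measure R]_(t in `[a, +oo[%classic) f t).
  have -> : `[a, +oo[%classic = (`[0, +oo[ `&` `[a, +oo[)%classic :> set R.
    rewrite predeqE => t /=; rewrite !in_itv/= !andbT; split=> [h|[]//].
    by split=> //; exact: le_trans h.
  rewrite Rintegral_mkcondr; apply: eq_Rintegral => t _.
  rewrite patchE /Bset -/a.
  case: ifPn => [|]; rewrite ?inE ?notin_setE/= in_itv/= andbT.
    by move=> ->; rewrite mul1r.
  by move=> /negP/negbTE ->; rewrite !mul0r.
rewrite (@Rintegral_ge0_continuous_FTC2y _ f (fun t => - expR (- (t / delta))) _ 0).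
- by rewrite sub0r opprK.
- by move=> t _; rewrite mulr_ge0 ?invr_ge0 ?ltW// expR_gt0.
- apply: continuous_subspaceT => t.
  by apply: cvgM; [exact: cvg_cst|exact: cE].
- rewrite -oppr0; apply: cvgN.
  rewrite (_ : (fun t => expR (- (t / delta))) =
               (fun z => expR (- z)) \o (fun z => delta^-1 * z)); last first.
    by apply/funext => t /=; rewrite mulrC.
  apply: (@cvg_comp _ _ _ _ _ _ (pinfty_nbhs R)); last exact: cvgr_expR.
  by apply: gt0_cvgMry; rewrite ?invr_gt0.
- by move=> t _; exact: ex_derive.
- by apply: cvgN; apply/cvg_at_right_filter; exact: cE.
- move=> t _; rewrite derive1E /f.
  have d1 : is_derive t (1 : R) (fun s : R => - (s / delta)) (- delta^-1).
    have -> : (fun s : R => - (s / delta)) = - (delta^-1 *: (@id R)).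
      by apply/funext => s; rewrite /= mulrC.
    by apply: is_derive_eq; rewrite /GRing.scale/= mulr1.
  have d2 := @is_derive1_comp R expR (fun s => - (s / delta)) _ _ _
    (is_derive_expR (- (t / delta))) d1.
  have d3 := is_deriveN d2.
  have := @derive_val _ _ _ _ _ _ _ d3.
  by rewrite mulrN opprK mulrC.
Qed.

Lemma conv_ge0 (f h : G -> R) x :
  (forall y, 0 <= f y) -> (forall y, 0 <= h y) -> 0 <= conv f h x.
Proof. by move=> f0 h0; apply: sumr_ge0 => y _; rewrite mulr_ge0. Qed.

Lemma sum_conv (f h : G -> R) :
  \sum_x conv f h x = (\sum_x f x) * (\sum_x h x).
Proof.
rewrite exchange_big/= mulr_suml; apply: eq_bigr => y _.
by rewrite -mulr_sumr [in RHS](reindex_inj (addIr (- y))).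
Qed.

Lemma convC (f h : G -> R) x : conv f h x = conv h f x.
Proof.
rewrite /conv (reindex_inj (inj_comp (addrI x) (@oppr_inj G)))/=.
by apply: eq_bigr => y _; rewrite opprB [x + (y - x)]addrC subrK mulrC.
Qed.

Lemma convA (f h k : G -> R) x : conv (conv f h) k x = conv f (conv h k) x.
Proof.
rewrite /conv.
under eq_bigr do rewrite mulr_suml.
rewrite exchange_big/=; apply: eq_bigr => y _; rewrite mulr_sumr.
rewrite (reindex_inj (addIr y)); apply: eq_bigr => z _.
by rewrite addrK mulrA opprD addrCA addrC.
Qed.

Lemma dist_le_of_ratio (u a b : R) : 0 <= u -> 0 <= a -> 0 <= b ->
  (1 - u) * b <= a -> (1 - u) * a <= b -> `|a - b| <= u * (a + b).
Proof. by move=> u0 a0 b0 h1 h2; rewrite ler_norml; apply/andP; split; nra. Qed.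

Section Fixed.
Variables (Gam : seq {ffun G -> R[i]}) (delta : R).
Hypotheses (cG : chars Gam) (d0 : 0 < delta).
Local Notation nrm := (gnorm Gam).

Lemma Btilde_gt0 x : 0 < Btilde Gam delta x.
Proof. by rewrite BtildeE// expR_gt0. Qed.

Lemma sum_Btilde_gt0 : 0 < \sum_x Btilde Gam delta x.
Proof.
rewrite (bigD1 0)//= ltr_pwDl ?Btilde_gt0// sumr_ge0// => x _.
exact/ltW/Btilde_gt0.
Qed.

Lemma beta_ge0 x : 0 <= beta Gam delta x.
Proof. by rewrite divr_ge0 ?ltW ?sum_Btilde_gt0 ?Btilde_gt0. Qed.

Lemma sum_beta : \sum_x beta Gam delta x = 1.
Proof. by rewrite -mulr_suml mulfV// gt_eqF ?sum_Btilde_gt0. Qed.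

Lemma betaN x : beta Gam delta (- x) = beta Gam delta x.
Proof. by rewrite /beta (BtildeE _ x d0) (BtildeE _ (- x) d0) gnormN. Qed.

(** The triangle inequality in the exponent costs a factor [expR (- (nrm y / delta))], which is at
    least [1 - nrm y / delta]. *)
Lemma beta_shift x y :
  (1 - nrm y / delta) * beta Gam delta x <= beta Gam delta (x + y).
Proof.
rewrite /beta mulrA ler_pM2r ?invr_gt0 ?sum_Btilde_gt0// !BtildeE//.
apply: (@le_trans _ _ (expR (- (nrm y / delta)) * expR (- (nrm x / delta)))).
  by rewrite ler_pM2r ?expR_gt0// expR_ge1Dx.
rewrite -expRD ler_expR -opprD lerN2 -mulrDl ler_pM2r ?invr_gt0//.
by rewrite addrC gnormD.
Qed.

Lemma psi_ge0 x : 0 <= psi Gam delta x.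
Proof. exact: conv_ge0 beta_ge0 beta_ge0. Qed.

Lemma sum_psi : \sum_x psi Gam delta x = 1.
Proof. by rewrite sum_conv sum_beta mulr1. Qed.

Lemma psiN x : psi Gam delta (- x) = psi Gam delta x.
Proof.
rewrite /psi /conv [LHS](reindex_inj (@oppr_inj G)); apply: eq_bigr => y _.
by rewrite betaN -opprD betaN.
Qed.

Lemma psi_shift x y :
  (1 - nrm y / delta) * psi Gam delta x <= psi Gam delta (x + y).
Proof.
rewrite /psi /conv mulr_sumr; apply: ler_sum => z _.
by rewrite mulrCA ler_wpM2l ?beta_ge0// addrAC beta_shift.
Qed.

Lemma psi_dist x y : `|psi Gam delta (x + y) - psi Gam delta x|
  <= nrm y / delta * (psi Gam delta (x + y) + psi Gam delta x).
Proof.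
have h1 := psi_shift x y.
have := psi_shift (x + y) (- y); rewrite gnormN// addrK => h2.
have u0 : 0 <= nrm y / delta by rewrite divr_ge0 ?gnorm_ge0// ltW.
exact: dist_le_of_ratio u0 (psi_ge0 _) (psi_ge0 _) h1 h2.
Qed.

(** Sum the pointwise bound: [psi] and its translate both have mass 1, hence the factor 2. *)
Lemma psi_L1 y :
  \sum_x `|psi Gam delta (x + y) - psi Gam delta x| <= 2 * (nrm y / delta).
Proof.
apply: le_trans (ler_sum _ (fun x _ => psi_dist x y)) _.
have e : \sum_x psi Gam delta (x + y) = 1.
  by rewrite -[RHS]sum_psi [RHS](reindex_inj (addIr y)).
by rewrite -mulr_sumr big_split/= e sum_psi mulrC -mulr2n.
Qed.

End Fixed.
End Kernel.

(** * Doubling of Bohr sets and the mean of the norm *)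

Section Cells.
Variables (R : realType) (G : finZmodType).
Implicit Types (g : {ffun G -> R[i]}) (Gam : seq {ffun G -> R[i]}) (x y : G).

Lemma near_of_truncn_eq (u v s : R) : 0 < s -> 0 <= u -> 0 <= v ->
  Num.trunc (u / s) = Num.trunc (v / s) -> `|u - v| <= s.
Proof.
move=> s0 u0 v0 e.
have := truncn_itv (divr_ge0 u0 (ltW s0)); have := truncn_itv (divr_ge0 v0 (ltW s0)).
rewrite -e !ler_pdivlMr// !ltr_pdivrMr// -natr1 mulrDl mul1r.
move: (_ * s) => w /andP[h1 h2] /andP[h3 h4].
by rewrite ler_norml; apply/andP; split; lra.
Qed.

(** The arguments on [S] lie in an interval of length [2 * a]. Pieces of length [2 * pi * rho]
    number at most [m.+1], and the code of a point records its piece for every character. *)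
Lemma cells Gam (S : {set G}) (rho a : R) (m : nat) :
  chars Gam -> 0 < rho -> 0 <= a -> a / (pi * rho) < m.+1%:R ->
  (forall x g, x \in S -> g \in Gam -> `|carg (g x)| <= a) ->
  exists code : G -> {ffun 'I_(size Gam) -> 'I_m.+1},
    forall x y, x \in S -> y \in S -> code x = code y -> gnorm Gam (x - y) <= rho.
Proof.
move=> cG r0 a0 am aS.
have s0 : 0 < rho * (2 * pi) by rewrite mulr_gt0// twopi_gt0.
pose tr (g : {ffun G -> R[i]}) x := Num.trunc ((carg (g x) + a) / (rho * (2 * pi))).
(* [inord] is faithful only below [m.+1], which [bnd] secures on [S] alone. *)
pose code x := [ffun i : 'I_(size Gam) => inord (tr (nth [ffun=> 0] Gam i) x) : 'I_m.+1].
exists code => x y xS yS cxy; apply: gnormB_le => // [|g gG]; first exact: ltW.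
have pos z : z \in S -> 0 <= carg (g z) + a.
  by move=> zS; have := aS z g zS gG; rewrite ler_norml => /andP[]; lra.
have bnd z : z \in S -> (tr g z < m.+1)%N.
  move=> zS; rewrite truncn_lt_nat ?divr_ge0 ?pos ?ltW//.
  apply: le_lt_trans am.
  have -> : a / (pi * rho) = (a + a) / (rho * (2 * pi)).
    have: rho != 0 by rewrite gt_eqF.
    have: pi != 0 :> R by rewrite gt_eqF ?pi_gt0.
    by move: (pi : R) => p p0 rho0; field; rewrite p0 rho0.
  rewrite ler_pM2r ?invr_gt0// lerD2r.
  exact: le_trans (ler_norm _) (aS _ _ zS gG).
have gi : (index g Gam < size Gam)%N by rewrite index_mem.
have /ffunP/(_ (Ordinal gi)) := cxy; rewrite !ffunE/= nth_index//.
move=> /(congr1 (@nat_of_ord _)); rewrite !inordK ?bnd// => e.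
have := near_of_truncn_eq s0 (pos x xS) (pos y yS) e.
by rewrite opprD addrACA subrr addr0.
Qed.

Lemma card_code K m : #|{ffun 'I_K -> 'I_m}| = (m ^ K)%N.
Proof. by rewrite card_ffun !card_ord. Qed.

Definition ball Gam (t : R) : {set G} := [set x | gnorm Gam x <= t].

(** On the large ball the arguments are at most [4 * pi * t], so cells of width [t] need five pieces
    per character. Subtracting one of its points moves a cell into the small ball. *)
Lemma ball_doubling Gam t : chars Gam -> 0 < t ->
  (#|ball Gam (2 * t)| <= 5 ^ size Gam * #|ball Gam t|)%N.
Proof.
move=> cG t0; set S := ball Gam (2 * t).
have aS x g : x \in S -> g \in Gam -> `|carg (g x)| <= 4 * (pi * t).
  rewrite inE => xS gG; have := le_trans (argn_le_gnorm x gG) xS.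
  by rewrite /argn ler_pdivrMr ?twopi_gt0//; lra.
have a0 : 0 <= 4 * (pi * t) by rewrite !mulr_ge0 ?pi_ge0 ?ltW.
have am : 4 * (pi * t) / (pi * t) < 4.+1%:R.
  by rewrite mulfK ?gt_eqF ?mulr_gt0 ?pi_gt0// ltr_nat.
have [code hc] := cells cG t0 a0 am aS.
rewrite -card_code -sum_nat_const -sum1_card.
rewrite (partition_big code xpredT)//=; apply: leq_sum => c _.
rewrite sum1_card.
case: (pickP [pred x in S | code x == c]) => [x0 /andP[/= x0S /eqP x0c]|h]; last first.
  by rewrite eq_card0// => x; have := h x; rewrite !inE.
rewrite -(card_imset _ (addIr (- x0))) subset_leq_card//.
apply/fintype.subsetP => _ /imsetP[x + ->].
rewrite -topredE/= => /andP[xS /eqP xc]; rewrite inE.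
by apply: hc; rewrite ?xc.
Qed.

(** The ratio is at most [4 / 5], since [expR (1 / 4) >= 5 / 4]. *)
Lemma sum_geom_quarter n : \sum_(i < n) expR (- (i%:R / 4)) <= 5 :> R.
Proof.
set q : R := expR (- (1 / 4)).
have q0 : 0 < q by exact: expR_gt0.
have q1 : q <= 4 / 5.
  rewrite /q expRN invf_ple ?posrE ?expR_gt0 ?divr_gt0//.
  by apply: le_trans (expR_ge1Dx _); lra.
have -> : \sum_(i < n) expR (- (i%:R / 4)) = \sum_(i < n) q ^+ i.
  apply: eq_bigr => i _; by rewrite /q -expRM_natl; congr expR; lra.
have := subrX1 q n.
have := exprn_ge0 n (ltW q0).
have : 0 <= \sum_(i < n) q ^+ i by apply: sumr_ge0 => i _; rewrite exprn_ge0// ltW.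
by move: (\sum_(i < n) _) (q ^+ n) => s t; nra.
Qed.

Lemma expR_half_le : expR (1 / 2) <= 2 :> R.
Proof.
rewrite -[leLHS]invrK -expRN invf_ple ?posrE ?expR_gt0 ?invr_gt0//.
by apply: le_trans (expR_ge1Dx _); lra.
Qed.

(* Sort the points by the integer part of [|x| / delta]; doubling replaces each
   level by one at half the radius, and the slack between the exponents [3/4]
   and [1/2] leaves a convergent geometric series over the levels. *)
Lemma sum_expR_doubling Gam delta : chars Gam -> 0 < delta ->
  \sum_x expR (- (3 / 4 * (gnorm Gam x / delta)))
  <= 10 * 5 ^+ size Gam * \sum_x expR (- (gnorm Gam x / delta)).
Proof.
move=> cG d0; set K := size Gam.
pose u x := gnorm Gam x / delta.
have u0 x : 0 <= u x by rewrite divr_ge0 ?gnorm_ge0// ltW.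
pose j x := Num.trunc (u x); pose J := \max_x j x.
pose e (i : nat) : R := expR (- (3 / 4 * i%:R)).
have ball_u (i : nat) (c : R) x :
    (x \in ball Gam (c * (i.+1%:R / 2 * delta))) = (u x <= c * (i.+1%:R / 2)).
  by rewrite inE /u ler_pdivrMr// mulrA.
have card_ball (t : R) : #|ball Gam t|%:R = \sum_x (x \in ball Gam t)%:R :> R.
  by rewrite -sum1_card natr_sum big_mkcond/=; apply: eq_bigr => x _; case: ifP.
apply: (@le_trans _ _ (\sum_(i < J.+1) e i * #|ball Gam (2 * (i.+1%:R / 2 * delta))|%:R)).
  under [leRHS]eq_bigr do rewrite card_ball mulr_sumr.
  rewrite exchange_big/=; apply: ler_sum => x _.
  have jJ : (j x < J.+1)%N by rewrite ltnS (leq_bigmax x).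
  have /andP[h1 h2] := truncn_itv (u0 x).
  rewrite (bigD1 (Ordinal jJ))//= ball_u.
  have -> : 2 * ((j x).+1%:R / 2) = (j x).+1%:R :> R by lra.
  rewrite (ltW h2) mulr1.
  apply: (@le_trans _ _ (e (j x))).
    by rewrite ler_expR lerN2 ler_pM2l ?divr_gt0.
  by rewrite lerDl sumr_ge0// => i _; rewrite mulr_ge0 ?expR_ge0.
apply: (@le_trans _ _ (\sum_(i < J.+1) e i * (5 ^+ K * #|ball Gam (i.+1%:R / 2 * delta)|%:R))).
  apply: ler_sum => i _; rewrite ler_pM2l ?expR_gt0//.
  by rewrite -natrX -natrM ler_nat ball_doubling// mulr_gt0 ?divr_gt0.
under eq_bigr do rewrite mulrCA card_ball mulr_sumr.
rewrite -mulr_sumr exchange_big/= [10 * _]mulrC -mulrA ler_pM2l ?exprn_gt0//.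
rewrite mulr_sumr; apply: ler_sum => x _.
(* In the ball of level [i] one has [u x <= (i + 1) / 2], so [3 / 4 * i >= u x - 1 / 2 + i / 4]. *)
apply: (@le_trans _ _ (\sum_(i < J.+1) 2 * expR (- u x) * expR (- (i%:R / 4)))).
  apply: ler_sum => i _; have := ball_u i 1 x; rewrite !mul1r => ->.
  case: (lerP (u x)) => [h|_]; last by rewrite mulr0 !mulr_ge0 ?expR_ge0.
  rewrite mulr1; apply: (@le_trans _ _ (expR (1 / 2) * expR (- u x) * expR (- (i%:R / 4)))).
    by rewrite -!expRD ler_expR; move: h; rewrite -natr1; lra.
  by rewrite -!mulrA ler_wpM2r ?mulr_ge0 ?expR_ge0// expR_half_le.
rewrite -mulr_sumr; apply: le_trans (ler_wpM2l _ (sum_geom_quarter _)) _.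
  by rewrite mulr_ge0 ?expR_ge0.
by rewrite /u; lra.
Qed.

(** Bound the exponential from below by its tangent at [M], namely [expR M * (1 + (u x - M))], and
    average. *)
Lemma jensen_expR (w u : G -> R) (M : R) : (forall x, 0 <= w x) ->
  \sum_x w x * expR (u x) <= expR M * \sum_x w x ->
  \sum_x w x * u x <= M * \sum_x w x.
Proof.
move=> w0 h.
have : \sum_x expR M * (w x * (1 + (u x - M))) <= expR M * \sum_x w x.
  apply: le_trans h; apply: ler_sum => x _; rewrite mulrCA ler_wpM2l//.
  rewrite -{2}(subrK M (u x)) expRD mulrC ler_wpM2r ?expR_ge0//.
  exact: expR_ge1Dx.
rewrite -mulr_sumr ler_pM2l ?expR_gt0//.
have -> : \sum_x w x * (1 + (u x - M))
    = \sum_x w x + \sum_x w x * u x - M * \sum_x w x.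
  by rewrite mulr_sumr -big_split -sumrB; apply: eq_bigr => x _ /=; ring.
by lra.
Qed.

(** Doubling bounds the exponential moment of a quarter of the scaled norm by
    [10 * 5 ^+ K <= expR (6 * K)]. Jensen then bounds its mean by [6 * K], and [24 = 4 * 6]. *)
Lemma beta_mean_gnorm Gam delta : chars Gam -> 0 < delta ->
  \sum_x beta Gam delta x * gnorm Gam x <= 24 * (size Gam)%:R * delta.
Proof.
move=> cG d0; set K := size Gam.
(* The bound [10 * 5 ^+ K <= 50 ^+ K] below requires [K > 0]; without characters the norm
   vanishes. *)
have [K0|K0] := posnP K.
  rewrite K0 mulr0 mul0r big1// => x _.
  by move/size0nil: K0 => ->; rewrite gnorm_nil mulr0.
have S0 := sum_Btilde_gt0 Gam d0.
have e : \sum_x beta Gam delta x * gnorm Gam x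
   = (\sum_x Btilde Gam delta x * (1 / 4 * (gnorm Gam x / delta))) * 4 * delta
     / \sum_x Btilde Gam delta x.
  rewrite !mulr_suml; apply: eq_bigr => x _; rewrite /beta.
  by move: (\sum_x _) S0 => S S0; field; rewrite !gt_eqF.
rewrite e ler_pdivrMr// -[_ * delta * _]mulrAC ler_pM2r//.
suff : \sum_x Btilde Gam delta x * (1 / 4 * (gnorm Gam x / delta))
    <= 6 * K%:R * \sum_x Btilde Gam delta x.
  by move: (\sum_x _) (\sum_x _) => a b; lra.
apply: jensen_expR => [x|]; first exact/ltW/Btilde_gt0.
have -> : \sum_x Btilde Gam delta x * expR (1 / 4 * (gnorm Gam x / delta))
    = \sum_x expR (- (3 / 4 * (gnorm Gam x / delta))).
  by apply: eq_bigr => x _; rewrite BtildeE// -expRD; congr expR; lra.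
apply: le_trans (sum_expR_doubling cG d0) _.
have -> : \sum_x expR (- (gnorm Gam x / delta)) = \sum_x Btilde Gam delta x.
  by apply: eq_bigr => x _; rewrite BtildeE.
rewrite ler_pM2r// -/K.
apply: (@le_trans _ _ (50 ^+ K)).
  case: K K0 => // n _; rewrite !exprS mulrA -natrM ler_pM2l//.
  by rewrite lerXn2r ?nnegrE// ler_nat.
rewrite mulrC expRM_natl lerXn2r ?nnegrE ?expR_ge0//.
have e1 : 2 <= expR 1 :> R by apply: le_trans (expR_ge1Dx _); lra.
have -> : expR 6 = expR 1 ^+ 6 :> R by rewrite -expRM_natl mulr1.
(* This is [50 <= 64]. *)
apply: (@le_trans _ _ (2 ^+ 6)); first by rewrite -natrX ler_nat.
by rewrite lerXn2r ?nnegrE ?expR_ge0.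
Qed.

Lemma psi_mean_gnorm Gam delta : chars Gam -> 0 < delta ->
  \sum_x psi Gam delta x * gnorm Gam x <= 48 * (size Gam)%:R * delta.
Proof.
move=> cG d0; have b0 := beta_ge0 Gam d0; have sb := sum_beta Gam d0.
have m := beta_mean_gnorm cG d0.
have -> : \sum_x psi Gam delta x * gnorm Gam x
    = \sum_y \sum_x beta Gam delta y * beta Gam delta x * gnorm Gam (x + y).
  under eq_bigr do rewrite mulr_suml.
  rewrite exchange_big/=; apply: eq_bigr => y _.
  by rewrite (reindex_inj (addIr y)); apply: eq_bigr => x _; rewrite addrK.
apply: (@le_trans _ _ (\sum_y \sum_x (beta Gam delta y * (beta Gam delta x * gnorm Gam x)
    + (beta Gam delta y * gnorm Gam y) * beta Gam delta x))).
  apply: ler_sum => y _; apply: ler_sum => x _.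
  have := gnormD x y cG; have := mulr_ge0 (b0 y) (b0 x).
  move: (beta _ _ x) (beta _ _ y) (gnorm _ x) (gnorm _ y) (gnorm _ _) => a b u v w ab0 h.
  by have -> : b * (a * u) + b * v * a = b * a * (u + v); [ring|rewrite ler_wpM2l].
under eq_bigr do rewrite big_split/= -!mulr_sumr sb mulr1.
rewrite big_split/= -mulr_suml sb mul1r.
by move: m; lra.
Qed.

End Cells.

(** * Energy increments and local Fourier coefficients *)

Section Energy.
Variables (R : realType) (G : finZmodType).
Variables (f P Q : G -> R).
Hypotheses (f01 : forall x, 0 <= f x <= 1).
Hypotheses (P0 : forall x, 0 <= P x) (P1 : \sum_x P x = 1).
Hypotheses (PN : forall x, P (- x) = P x).
Hypotheses (Q0 : forall x, 0 <= Q x) (Q1 : \sum_x Q x = 1).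
Variable tau : R.
(** [P] is the wide kernel and [Q] the narrow one: smoothing [P] by [Q] moves it by at most [tau] in
    [L1]. *)
Hypothesis hQP : \sum_m Q m * \sum_n `|P (n - m) - P n| <= tau.

Lemma conv01 x : 0 <= conv f P x <= 1.
Proof.
apply/andP; split.
  by apply: conv_ge0 => // y; have /andP[] := f01 y.
rewrite convC -P1; apply: ler_sum => y _.
by rewrite ler_piMr//; have /andP[] := f01 (x - y).
Qed.

Lemma tau_ge0 : 0 <= tau.
Proof.
apply: le_trans hQP; apply: sumr_ge0 => m _; rewrite mulr_ge0//.
by apply: sumr_ge0 => n _.
Qed.

Lemma conv_conv_near x : `|conv (conv f Q) P x - conv f P x| <= tau.
Proof.
rewrite convA /conv -sumrB.
apply: (@le_trans _ _ (\sum_y `|conv Q P (x - y) - P (x - y)|)).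
  apply: le_trans (ler_norm_sum _ _ _) _; apply: ler_sum => y _.
  have /andP[fy0 fy1] := f01 y.
  by rewrite -mulrBr normrM ger0_norm// ler_piMl.
have -> : \sum_y `|conv Q P (x - y) - P (x - y)| = \sum_z `|conv Q P z - P z|.
  by rewrite [RHS](reindex_inj (inj_comp (addrI x) (@oppr_inj G))).
apply: le_trans hQP.
under [leRHS]eq_bigr do rewrite mulr_sumr.
rewrite exchange_big/=; apply: ler_sum => z _.
have -> : conv Q P z - P z = \sum_m Q m * (P (z - m) - P z).
  by under [RHS]eq_bigr do rewrite mulrBr; rewrite sumrB -mulr_suml Q1 mul1r.
apply: le_trans (ler_norm_sum _ _ _) _; apply: ler_sum => m _.
by rewrite normrM ger0_norm.
Qed.

(* Expanding the square, the cross term is the pairing of [f * P] with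
   [f * Q * P], which differs from [f * P] by at most [tau]. *)
Lemma energy_increment :
  \sum_x \sum_y (conv f Q (x + y) - conv f P x) ^+ 2 * P y
  <= \sum_x conv f Q x ^+ 2 - \sum_x conv f P x ^+ 2 + 2 * tau * #|G|%:R.
Proof.
set a := conv f P; set b := conv f Q; set c := conv b P.
have sq : \sum_x \sum_y b (x + y) ^+ 2 * P y = \sum_x b x ^+ 2.
  rewrite exchange_big/=.
  have e y : \sum_x b (x + y) ^+ 2 * P y = (\sum_x b x ^+ 2) * P y.
    by rewrite -mulr_suml [in RHS](reindex_inj (addIr y)).
  by under eq_bigr do rewrite e; rewrite -mulr_sumr P1 mulr1.
have cE x : \sum_y b (x + y) * P y = c x.
  rewrite /c convC /conv (reindex_inj (@oppr_inj G)).
  by apply: eq_bigr => y _; rewrite PN mulrC.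
have -> : \sum_x \sum_y (b (x + y) - a x) ^+ 2 * P y
    = \sum_x b x ^+ 2 - \sum_x 2 * a x * c x + \sum_x a x ^+ 2.
  rewrite -sq -sumrB -big_split; apply: eq_bigr => x _ /=.
  have -> : a x ^+ 2 = \sum_y a x ^+ 2 * P y by rewrite -mulr_sumr P1 mulr1.
  rewrite -cE mulr_sumr -sumrB -big_split.
  by apply: eq_bigr => y _ /=; ring.
have : \sum_x (2 * a x ^+ 2 - 2 * tau) <= \sum_x 2 * a x * c x.
  apply: ler_sum => x _; have := conv_conv_near x; rewrite -/a -/b -/c => h.
  have /andP[a0 a1] : 0 <= a x <= 1 := conv01 x.
  have t0 := tau_ge0; move: h; rewrite ler_norml => /andP[h1 _].
  by move: (a x) (c x) a0 a1 h1 => u v *; nra.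
rewrite sumrB -mulr_sumr sumr_const -[(2 * tau) *+ _]mulr_natr.
by move: (\sum_x 2 * a x * c x) (\sum_x a x ^+ 2) (\sum_x b x ^+ 2) => *; lra.
Qed.

(** The variance on the left of [energy_increment] is nonnegative. *)
Lemma energy_almost_increasing :
  \sum_x conv f P x ^+ 2 <= \sum_x conv f Q x ^+ 2 + 2 * tau * #|G|%:R.
Proof.
have : 0 <= \sum_x \sum_y (conv f Q (x + y) - conv f P x) ^+ 2 * P y.
  by do 2!apply: sumr_ge0 => ? _; rewrite mulr_ge0 ?sqr_ge0.
by move=> h; have := le_trans h energy_increment; lra.
Qed.

Lemma energy_le : \sum_x conv f P x ^+ 2 <= #|G|%:R.
Proof.
rewrite -[leRHS]mulr1 mulr_natl -sumr_const; apply: ler_sum => x _.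
by have /andP[a0 a1] := conv01 x; rewrite expr_le1.
Qed.

(* Cauchy-Schwarz for the probability measure [P]. *)
Lemma cmod_mean_sqr (a : G -> R) (g : G -> R[i]) : (forall n, cmod (g n) = 1) ->
  cmod (\sum_n (a n * P n)%:C%C * g n) ^+ 2 <= \sum_n a n ^+ 2 * P n.
Proof.
move=> ug; set s := \sum_n `|a n| * P n.
have s0 : 0 <= s by apply: sumr_ge0 => n _; rewrite mulr_ge0.
have h1 : cmod (\sum_n (a n * P n)%:C%C * g n) <= s.
  apply: le_trans (cmod_sum _) _; apply: ler_sum => n _.
  by rewrite cmodM cmod_real ug mulr1 normrM (ger0_norm (P0 n)).
apply: (@le_trans _ _ (s ^+ 2)); first by rewrite lerXn2r ?nnegrE ?cmod_ge0.
have : 0 <= \sum_n (`|a n| - s) ^+ 2 * P n.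
  by apply: sumr_ge0 => n _; rewrite mulr_ge0 ?sqr_ge0.
have -> : \sum_n (`|a n| - s) ^+ 2 * P n
    = \sum_n a n ^+ 2 * P n - 2 * s * s + s ^+ 2.
  have -> : s ^+ 2 = \sum_n s ^+ 2 * P n by rewrite -mulr_sumr P1 mulr1.
  rewrite {3}/s mulr_sumr -sumrB -big_split.
  apply: eq_bigr => n _ /=; rewrite -(real_normK (num_real (a n))).
  by move: `|a n| (P n) => *; ring.
by move: (\sum_n _ * _) s0 => t _; rewrite expr2; lra.
Qed.
End Energy.

(** * Local Fourier coefficients and their stability *)

Section LocalFourier.
Variables (R : realType) (G : finZmodType).
Implicit Types (g : {ffun G -> R[i]}) (Gam : seq {ffun G -> R[i]}) (x y : G).
Variables (f : G -> R) (Gam : seq {ffun G -> R[i]}) (delta : R).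
Hypotheses (f01 : forall x, 0 <= f x <= 1) (cG : chars Gam) (d0 : 0 < delta).
Local Notation P := (psi Gam delta).
Let P0 := psi_ge0 Gam d0.
Let P1 := sum_psi Gam d0.

(** With [f] the indicator of a set and [delta] the second radius, this is the sum in regularity
    condition (ii). *)
Definition local_coef x g : R[i] :=
  \sum_n ((f (x + n) - conv f P x) * P n)%:C%C * g n.

Lemma sum_shift (F : G -> R) h : \sum_n F (n + h) = \sum_n F n.
Proof. by rewrite [RHS](reindex_inj (addIr h)). Qed.

Lemma dist01 (u v : R) : 0 <= u <= 1 -> 0 <= v <= 1 -> `|u - v| <= 1.
Proof. by move=> /andP[? ?] /andP[? ?]; rewrite ler_norml; apply/andP; split; lra. Qed.

Lemma dist_prod (u v w p q : R) : `|u - v| <= 1 -> 0 <= q ->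
  `|(u - v) * p - (u - w) * q| <= `|q - p| + `|w - v| * q.
Proof.
move=> uv q0.
have -> : (u - v) * p - (u - w) * q = (u - v) * (p - q) + (w - v) * q by ring.
apply: le_trans (ler_normD _ _) _; rewrite !normrM (ger0_norm q0).
by rewrite lerD2r (distrC q) ler_piMl.
Qed.

Lemma phase_diff (s p q : R) (z w : R[i]) : `|s| <= 1 -> 0 <= q -> cmod z = 1 ->
  cmod ((s * p)%:C%C * z - (s * q)%:C%C * (z * w)) <= `|q - p| + q * cmod (w - 1).
Proof.
move=> s1 q0 uz.
have -> : (s * p)%:C%C * z - (s * q)%:C%C * (z * w)
    = s%:C%C * (- z) * ((q - p)%:C%C + q%:C%C * (w - 1)).
  by case: z {uz} => a b; case: w => c d; congr Complex => /=; ring.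
rewrite cmodM cmodM cmodN uz mulr1 cmod_real.
apply: le_trans (ler_piMl (cmod_ge0 _) s1) _; apply: le_trans (cmodD _ _) _.
by rewrite cmodM !cmod_real (ger0_norm q0).
Qed.

Lemma conv_psi_lip x h :
  `|conv f P (x + h) - conv f P x| <= 2 * (gnorm Gam h / delta).
Proof.
apply: le_trans (psi_L1 cG d0 h).
rewrite /conv -sumrB [leRHS](reindex_inj (inj_comp (addrI x) (@oppr_inj G)))/=.
apply: le_trans (ler_norm_sum _ _ _) _; apply: ler_sum => y _.
have /andP[fy0 fy1] := f01 y.
by rewrite -mulrBr normrM ger0_norm// addrAC ler_piMl.
Qed.

Lemma psi_L1N h : \sum_n `|P (n - h) - P n| <= 2 * (gnorm Gam h / delta).
Proof. by rewrite -(gnormN h cG); exact: psi_L1. Qed.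

(* Translating [x] by [h] multiplies the coefficient by the phase [g (- h)],
   up to an error controlled by the smoothness of [P]. *)
Lemma local_coef_lip x h g : is_character g ->
  cmod (local_coef x g) - 4 * (gnorm Gam h / delta) <= cmod (local_coef (x + h) g).
Proof.
move=> cg; have [g0 gM] := cg; have ug z := character_unimod z cg.
have e : local_coef (x + h) g * g h
    = \sum_n ((f (x + n) - conv f P (x + h)) * P (n - h))%:C%C * g n.
  rewrite [RHS](reindex_inj (addIr h)) mulr_suml; apply: eq_bigr => n _.
  by rewrite /= addrK gM mulrA -[x + h + n]addrA [h + n]addrC.
apply: (@le_trans _ _ (cmod (local_coef (x + h) g * g h))); last first.
  by rewrite (cmodM (local_coef (x + h) g)) (ug h) mulr1.
rewrite lerBlDr -lerBlDl; apply: le_trans (cmodB_ge _ _) _.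
rewrite e /local_coef -sumrB; apply: le_trans (cmod_sum _) _.
apply: (@le_trans _ _ (\sum_n (`|P (n - h) - P n|
   + `|conv f P (x + h) - conv f P x| * P (n - h)))).
  apply: ler_sum => n _; rewrite -mulrBl -rmorphB cmodM ug mulr1 cmod_real.
  by apply: dist_prod => //; apply: dist01; [exact: f01|exact: conv01].
rewrite big_split/= -mulr_sumr.
have -> : \sum_n P (n - h) = 1 by rewrite sum_shift.
have := conv_psi_lip x h; have := psi_L1N h.
by move: (\sum_n _) `|_| (_ / _) => *; lra.
Qed.

(** Replacing [f] by [f * Q] amounts to shifting the variable of [P] and [g] by a [Q]-random [m].
    The kernel then changes by its [L1] modulus and the phase by [g m - 1]. *)
Lemma local_coef_smooth (Q : G -> R) x g : is_character g ->
  (forall m, 0 <= Q m) -> \sum_m Q m = 1 ->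
  cmod (local_coef x g)
  <= cmod (\sum_n ((conv f Q (x + n) - conv f P x) * P n)%:C%C * g n)
     + \sum_m Q m * (2 * (gnorm Gam m / delta) + cmod (g m - 1)).
Proof.
move=> cg Q0 Q1; have [g0 gM] := cg; have ug z := character_unimod z cg.
rewrite -lerBlDl; apply: le_trans (cmodB_ge _ _) _.
set a := conv f P x.
have a01 : 0 <= a <= 1 by exact: conv01.
have eQ : \sum_n ((conv f Q (x + n) - a) * P n)%:C%C * g n
   = \sum_m (Q m)%:C%C * \sum_n ((f (x + n) - a) * P (n + m))%:C%C * g (n + m).
  under [RHS]eq_bigr do rewrite mulr_sumr.
  under [RHS]eq_bigr => m _ do rewrite (reindex_inj (addIr (- m)))/=.
  rewrite exchange_big/=; apply: eq_bigr => n _.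
  under [RHS]eq_bigr do rewrite subrK mulrA -rmorphM.
  rewrite -mulr_suml -raddf_sum/=; congr (_%:C%C * _).
  rewrite convC /conv.
  have ea : a = \sum_m Q m * a by rewrite -mulr_suml Q1 mul1r.
  rewrite [X in (_ - X) * _]ea -sumrB mulr_suml; apply: eq_bigr => m _.
  by rewrite -mulrBr -mulrA [x + (n - m)]addrA.
have eP : local_coef x g
   = \sum_m (Q m)%:C%C * \sum_n ((f (x + n) - a) * P n)%:C%C * g n.
  by rewrite -mulr_suml -raddf_sum/= Q1 mul1r.
rewrite eQ eP -sumrB; apply: le_trans (cmod_sum _) _; apply: ler_sum => m _.
rewrite -mulrBr cmodM cmod_real ger0_norm// ler_wpM2l// -sumrB.
apply: le_trans (cmod_sum _) _.
apply: (@le_trans _ _ (\sum_n (`|P (n + m) - P n| + P (n + m) * cmod (g m - 1)))).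
  apply: ler_sum => n _.
  by rewrite gM; apply: phase_diff => //; apply: dist01.
rewrite big_split/= -mulr_suml.
have -> : \sum_n P (n + m) = 1 by rewrite sum_shift.
by rewrite mul1r lerD2r; exact: psi_L1.
Qed.

End LocalFourier.

(** * One step of the energy increment argument *)

Section Step.
Variables (R : realType) (G : finZmodType).
Implicit Types (g : {ffun G -> R[i]}) (Gam : seq {ffun G -> R[i]}) (x y : G).
Local Notation N := (#|G|%:R : R).

(** The [L1] modulus, with constant 2, is averaged over the narrow kernel, whose mean norm carries
    the constant 48. *)
Lemma psi_tau Gam Gam' (delta delta' : R) : chars Gam' ->
  {subset Gam <= Gam'} -> 0 < delta -> 0 < delta' ->
  \sum_m psi Gam' delta' m * \sum_n `|psi Gam delta (n - m) - psi Gam delta n|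
  <= 96 * (size Gam')%:R * delta' / delta.
Proof.
move=> cG' sub d0 d0'; have cG : chars Gam by move=> g /sub/cG'.
apply: (@le_trans _ _ (\sum_m psi Gam' delta' m * gnorm Gam' m * (2 / delta))).
  apply: ler_sum => m _; rewrite -mulrA ler_wpM2l ?psi_ge0//.
  apply: le_trans (psi_L1N cG d0 m) _.
  by rewrite mulrCA; apply: ler_wpM2r; [rewrite divr_ge0// ltW|exact: gnorm_sub].
rewrite -mulr_suml; have := psi_mean_gnorm cG' d0'; move: (\sum_m _) => s h.
rewrite mulrA ler_pM2r ?invr_gt0//; lra.
Qed.

(* One character suffices for each cell of arguments, since the local
   coefficients vary slowly along a cell. *)
Lemma covering_characters (f : G -> R) Gam (delta eps : R) (B : {set G}) :
  (forall x, 0 <= f x <= 1) -> chars Gam -> 0 < delta -> 0 < eps ->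
  (forall x, x \in B ->
    exists2 g, is_character g & eps < cmod (local_coef f Gam delta x g)) ->
  exists Gam' : seq {ffun G -> R[i]},
    [/\ uniq Gam', chars Gam', {subset Gam <= Gam'},
     (size Gam' <= size Gam + (Num.trunc (16 / (eps * delta))).+1 ^ size Gam)%N &
     forall x, x \in B -> exists2 g, g \in Gam' &
       3 / 4 * eps <= cmod (local_coef f Gam delta x g)].
Proof.
move=> f01 cG d0 e0 hB; set M := Num.trunc _.
have [h hh] : exists h : G -> {ffun G -> R[i]}, forall x, x \in B ->
    is_character (h x) /\ eps < cmod (local_coef f Gam delta x (h x)).
  suff /boolp.choice[h hh] : forall x, exists g, x \in B ->
      is_character g /\ eps < cmod (local_coef f Gam delta x g) by exists h.
  move=> x; have [xB|xB] := boolP (x \in B); last by exists [ffun=> 0].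
  by have [g ? ?] := hB x xB; exists g.
(* Moving by [rho] changes a coefficient by at most [4 * rho / delta = eps / 4], which leaves
   [3 / 4 * eps]. *)
pose rho := eps * delta / 16.
have r0 : 0 < rho by rewrite divr_gt0 ?mulr_gt0.
have hM : pi / (pi * rho) < M.+1%:R.
  rewrite invfM mulrA divff ?gt_eqF ?pi_gt0// mul1r invf_div.
  by have /andP[] := truncn_itv (ltW (divr_gt0 (ltr0n R 16) (mulr_gt0 e0 d0))).
have [code hcode] := @cells R G Gam [set: G]%SET rho pi M cG r0 (pi_ge0 R) hM
  (fun x g _ gG => norm_carg_le_pi (character_unimod x (cG g gG))).
pose rep c := [pick x in B | code x == c].
pose new := [seq h x | x <- pmap rep (enum {ffun 'I_(size Gam) -> 'I_M.+1})].
exists (undup (Gam ++ new)); split.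
- exact: undup_uniq.
- move=> g; rewrite mem_undup mem_cat => /orP[/cG//|/mapP[x + ->]].
  rewrite mem_pmap => /mapP[c _]; rewrite /rep; case: pickP => // x0 /andP[x0B _] [->].
  by have [] := hh _ x0B.
- by move=> g gG; rewrite mem_undup mem_cat gG.
- apply: leq_trans (size_undup _) _; rewrite size_cat leq_add2l size_map size_pmap.
  by apply: leq_trans (count_size _ _) _; rewrite -cardE card_code.
- move=> x xB; case E : (rep (code x)) => [x0|]; last first.
    by move: E; rewrite /rep; case: pickP => // /(_ x); rewrite xB eqxx.
  have [x0B /eqP cx0] : x0 \in B /\ code x0 == code x.
    by move: E; rewrite /rep; case: pickP => // z /andP[? ?] [<-].
  have [ch big] := hh _ x0B; exists (h x0).
    rewrite mem_undup mem_cat; apply/orP; right; apply: map_f.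
    by rewrite mem_pmap; apply/mapP; exists (code x); rewrite ?mem_enum ?E.
  have near : gnorm Gam (x - x0) <= rho by apply: hcode; rewrite ?inE.
  have := local_coef_lip f01 cG d0 x0 (x - x0) ch.
  rewrite [x0 + _]addrC subrK; apply: le_trans.
  have : gnorm Gam (x - x0) / delta <= eps / 16.
    by rewrite ler_pdivrMr//; apply: le_trans near _; rewrite /rho; lra.
  by move: big; move: (cmod _) (_ / delta) => u v; lra.
Qed.

Lemma indic01 (A : {set G}) x : 0 <= indic R A x <= 1.
Proof. by rewrite /indic; case: (x \in A); rewrite ?lexx ?ler01. Qed.

Lemma sum_gain k (u v : 'I_k -> R) i0 D s :
  (forall i, u i <= v i + s) -> u i0 + D <= v i0 + s ->
  \sum_i u i + D <= \sum_i v i + k%:R * s.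
Proof.
move=> h h0.
have -> : \sum_i u i + D = \sum_i (u i + if i == i0 then D else 0).
  by rewrite big_split/= -big_mkcond big_pred1_eq.
have -> : \sum_i v i + k%:R * s = \sum_i (v i + s).
  by rewrite big_split/= sumr_const card_ord mulr_natl.
apply: ler_sum => i _; have [->//|_] := eqVneq i i0; rewrite addr0//.
Qed.

(** * Total energy of a family of sets *)

Section Family.
Variables (k : nat) (A : 'I_k -> {set G}).

Definition energy Gam (delta : R) : R :=
  \sum_(i < k) \sum_x conv (indic R (A i)) (psi Gam delta) x ^+ 2.

Lemma energy_ge0 Gam delta : 0 <= energy Gam delta.
Proof. by do 2!apply: sumr_ge0 => ? _; exact: sqr_ge0. Qed.

Lemma total_energy_le Gam delta : 0 < delta -> energy Gam delta <= k%:R * N.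
Proof.
move=> d0; rewrite -[k in leRHS]card_ord mulr_natl -sumr_const; apply: ler_sum => i _.
by apply: energy_le; [exact: indic01|exact: psi_ge0|exact: sum_psi].
Qed.

(** Only the set [i0] is known to gain; each set may lose [2 * tau * N], which accounts for the
    factor [k] in the error. [D = 0] is a useful case. *)
Lemma energy_gain Gam Gam' (delta delta' : R) (i0 : 'I_k) (D : R) : chars Gam' ->
  {subset Gam <= Gam'} -> 0 < delta -> 0 < delta' ->
  D <= \sum_x \sum_y (conv (indic R (A i0)) (psi Gam' delta') (x + y)
         - conv (indic R (A i0)) (psi Gam delta) x) ^+ 2 * psi Gam delta y ->
  energy Gam delta + D <= energy Gam' delta'
    + 2 * k%:R * (96 * (size Gam')%:R * delta' / delta) * N.
Proof.
move=> cG' sub d0 d0'; have cG : chars Gam by move=> g /sub/cG'.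
have tau := psi_tau cG' sub d0 d0'; set t := _ / delta in tau *.
move=> hD; have := @sum_gain k
  (fun i => \sum_x conv (indic R (A i)) (psi Gam delta) x ^+ 2)
  (fun i => \sum_x conv (indic R (A i)) (psi Gam' delta') x ^+ 2) i0 D (2 * t * N).
have -> : k%:R * (2 * t * N) = 2 * k%:R * t * N.
  by rewrite !mulrA [k%:R * 2]mulrC.
apply=> [i|].
  by apply: energy_almost_increasing tau; [exact: indic01|exact: psi_ge0|exact: sum_psi|
    exact: psiN|exact: psi_ge0|exact: sum_psi].
have h0 := energy_increment (indic01 (A i0)) (psi_ge0 Gam d0) (sum_psi Gam d0)
  (psiN cG d0) (psi_ge0 Gam' d0') (sum_psi Gam' d0') tau.
rewrite -lerBrDl [leRHS]addrAC; exact: le_trans hD h0.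
Qed.

Section Increment.
Variable eps : R.
Hypotheses (k0 : (0 < k)%N) (e0 : 0 < eps) (e1 : eps <= 1).
Let kR1 : 1 <= k%:R :> R. Proof. by rewrite ler1n. Qed.

Lemma eta2_bounds (Rs : seq {ffun G -> R[i]}) eta : 0 < eta <= 1 -> 0 < eta2 k eps Rs eta <= 1.
Proof.
move=> /andP[t0 t1]; rewrite /eta2; case: ifPn => [_|]; first by rewrite t0.
rewrite -lt0n => d0; have dR : 1 <= (size Rs)%:R :> R by rewrite ler1n.
have den : 1 <= (size Rs)%:R * k%:R ^+ 4 :> R.
  by rewrite mulr_ege1// exprn_ege1.
have den0 := lt_le_trans ltr01 den.
have c1 : 2 ^- 40 <= 1 :> R by rewrite invf_le1 ?exprn_gt0// exprn_ege1// ler1n.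
have c0 : 0 < 2 ^- 40 :> R by rewrite invr_gt0 exprn_gt0.
apply/andP; split; first by rewrite divr_gt0// !mulr_gt0// exprn_gt0.
rewrite ler_pdivrMr// mul1r; apply: le_trans den.
have x0 : 0 <= eps ^+ 6 by rewrite exprn_ge0 ?ltW.
have x1 : eps ^+ 6 <= 1 by rewrite exprn_ile1// ltW.
have y1 : 2 ^- 40 * eps ^+ 6 <= 1 by apply: mulr_ile1 => //; exact: ltW.
by apply: mulr_ile1 => //; [rewrite mulr_ge0// ltW|exact: ltW].
Qed.

(** The choice of [eta2] turns the loss into [192 * 2 ^- 40 * eps ^+ 6 / k ^+ 3], and
    [192 * 64 <= 2 ^ 14]. *)
Lemma eta2_loss (Rs : seq {ffun G -> R[i]}) eta : 0 < eta ->
  2 * k%:R * (96 * (size Rs)%:R * eta2 k eps Rs eta / eta) <= eps ^+ 3 / 64.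
Proof.
move=> t0; have e30 : 0 < eps ^+ 3 by rewrite exprn_gt0.
rewrite /eta2; case: ifPn => [/eqP->|]; first by rewrite mulr0 !mul0r mulr0 divr_ge0// ltW.
rewrite -lt0n => d0; have dR : 0 < (size Rs)%:R :> R by rewrite ltr0n.
have kR : 0 < k%:R :> R by rewrite ltr0n.
have -> : 2 * k%:R * (96 * (size Rs)%:R *
    (2 ^- 40 * eps ^+ 6 * eta / ((size Rs)%:R * k%:R ^+ 4)) / eta)
  = (192 * 2 ^- 40) * (eps ^+ 3 * k%:R ^- 3) * eps ^+ 3.
  move: (2 ^- 40) (k%:R : R) kR ((size Rs)%:R : R) dR => c K K0 d {}d0.
  by field; rewrite !gt_eqF.
rewrite mulrC ler_pM2l//.
have h1 : 192 * 2 ^- 40 <= 64^-1 :> R.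
  rewrite ler_pdivrMr ?exprn_gt0// mulrC ler_pdivlMr//.
  apply: (@le_trans _ _ (2 ^+ 14)); last by rewrite ler_weXn2l ?ler1n.
  by rewrite -natrX -natrM ler_nat.
have h2 : eps ^+ 3 * k%:R ^- 3 <= 1.
  rewrite ler_pdivrMr ?exprn_gt0// mul1r.
  by rewrite (le_trans (exprn_ile1 _ (ltW e0) e1))// exprn_ege1.
have h3 : 0 <= eps ^+ 3 * k%:R ^- 3 by rewrite mulr_ge0 ?invr_ge0 ?exprn_ge0 ?(ltW e0).
have h4 : 0 <= 192 * 2 ^- 40 :> R by rewrite mulr_ge0// invr_ge0 exprn_ge0.
by move: (192 * _) (_ * k%:R ^- 3) h1 h2 h3 h4 => *; nra.
Qed.

Lemma sum_ge_card (F : G -> R) (B : {set G}) c :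
  (forall x, 0 <= F x) -> (forall x, x \in B -> c <= F x) -> c * #|B|%:R <= \sum_x F x.
Proof.
move=> F0 FB; rewrite (bigID (mem B))/= -[leLHS]addr0 lerD ?sumr_ge0//.
by rewrite mulr_natr -sumr_const; apply: ler_sum.
Qed.

(** Kernel and phase errors add up to [18 / delta] times the norm, where [delta <= 1] absorbs the
    phase term; [864 = 48 * 18]. *)
Lemma psi_coef_smooth f Gam Gam' (delta delta' : R) x g :
  (forall x, 0 <= f x <= 1) -> chars Gam' -> {subset Gam <= Gam'} -> g \in Gam' ->
  0 < delta <= 1 -> 0 < delta' ->
  cmod (local_coef f Gam delta x g)
  <= cmod (\sum_n ((conv f (psi Gam' delta') (x + n) - conv f (psi Gam delta) x)
                    * psi Gam delta n)%:C%C * g n)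
     + 864 * ((size Gam')%:R * delta' / delta).
Proof.
move=> f01 cG' sub gG' /andP[d0 d1] d0'.
have cG : chars Gam by move=> h /sub/cG'.
apply: le_trans (local_coef_smooth f01 cG d0 x (cG' _ gG') (psi_ge0 Gam' d0')
  (sum_psi Gam' d0')) _.
rewrite lerD2l.
apply: (@le_trans _ _ (\sum_m psi Gam' delta' m * gnorm Gam' m * (18 / delta))).
  apply: ler_sum => m _; rewrite -mulrA ler_wpM2l ?psi_ge0//.
  apply: (@le_trans _ _ (2 * (gnorm Gam' m / delta) + 16 * (gnorm Gam' m / delta))).
    apply: lerD; first by rewrite ler_pM2l// ler_pM2r ?invr_gt0// gnorm_sub.
    apply: le_trans (cmod_characterB1 m cG' gG') _; rewrite ler_pM2l//.
    by rewrite ler_pdivlMr// ler_piMr ?gnorm_ge0.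
  by move: (gnorm _ _) (delta^-1) => *; lra.
rewrite -mulr_suml; have := psi_mean_gnorm cG' d0'; move: (\sum_m _) => s h.
have -> : 864 * ((size Gam')%:R * delta' / delta) = 48 * (size Gam')%:R * delta' * (18 / delta).
  by move: (delta^-1) => v; ring.
by rewrite ler_pM2r ?divr_gt0.
Qed.

Lemma gain_uniform (E E' L t n : R) : 0 <= n -> 0 <= t -> L <= t / 64 ->
  E + t / 2 * n <= E' + L * n -> E + t / 16 * n <= E'.
Proof. by move=> n0 t0 /(ler_wpM2r n0) hL; have := mulr_ge0 t0 n0; lra. Qed.

(** Budget for two moves: narrowing the kernel may lose [t / 64], and enlarging the character set
    then gains [t / 8 - t / 64]. *)
Lemma gain_fourier (E E1 E' L L' t n : R) : 0 <= n -> 0 <= t ->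
  L <= t / 64 -> L' <= t / 64 -> E + 0 <= E1 + L * n ->
  E1 + t / 8 * n <= E' + L' * n -> E + t / 16 * n <= E'.
Proof.
move=> n0 t0 /(ler_wpM2r n0) hL /(ler_wpM2r n0) hL'.
by have := mulr_ge0 t0 n0; lra.
Qed.

Lemma loss_arith (u t : R) : 0 <= t -> u * (128 * 128) <= t -> 192 * u <= t / 64.
Proof. by lra. Qed.

Lemma coef_arith (e a w u t : R) : 0 <= e -> 3 / 4 * e <= a + 864 * w -> w <= u ->
  u * (128 * 128) <= t -> t <= e -> e / 2 <= a.
Proof. by lra. Qed.

Lemma energy_step (Rs : seq {ffun G -> R[i]}) eta :
  uniq Rs -> chars Rs -> 0 < eta <= 1 ->
  ~ (forall i, regular_pair k eps (A i) Rs eta) ->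
  let delta := eta2 k eps Rs eta in
  exists (Rs' : seq {ffun G -> R[i]}) eta',
    [/\ uniq Rs', chars Rs', 0 < eta' <= 1,
        energy Rs eta + eps ^+ 3 / 16 * N <= energy Rs' eta' &
        (size Rs' <= size Rs + (Num.trunc (16 / (eps * delta))).+1 ^ size Rs)%N /\
        delta * eps ^+ 3 / (2 ^+ 20 * k%:R * (size Rs').+1%:R) <= eta'].
Proof.
move=> uR cR t01 nreg delta; have /andP[t0 t1] := t01.
have d01 : 0 < delta <= 1 := eta2_bounds Rs t01; have /andP[d0 d1] := d01.
have loss : 2 * k%:R * (96 * (size Rs)%:R * delta / eta) <= eps ^+ 3 / 64 :=
  eta2_loss Rs t0.
have N0 : 0 <= N by exact: ler0n.
have e30 : 0 < eps ^+ 3 by rewrite exprn_gt0.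
have kR : 0 < k%:R :> R by rewrite ltr0n.
have [i nregi] : exists i, ~ regular_pair k eps (A i) Rs eta.
  by apply: contrapT => h; apply: nreg => i; apply: contrapT => hi; apply: h; exists i.
pose F x := \sum_y (conv (indic R (A i)) (psi Rs delta) (x + y)
  - conv (indic R (A i)) (psi Rs eta) x) ^+ 2 * psi Rs eta y.
pose B1 := [set x | eps ^+ 2 < F x]%SET.
pose B2 := [set x | `[< exists2 g, is_character g &
  eps < cmod (local_coef (indic R (A i)) Rs delta x g) >]]%SET.
(* Every irregular point violates (i), so lies in [B1], or (ii), so lies in [B2]. *)
have bad : eps * N <= #|B1|%:R + #|B2|%:R.
  move/negP: nregi; rewrite -leNgt => /le_trans; apply; rewrite -natrD ler_nat.
  apply: leq_trans (leq_card_setU B1 B2); apply/subset_leq_card/fintype.subsetP => x.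
  rewrite !inE => /negP; apply: contra_notT; rewrite negb_or -leNgt => /andP[h1 /asboolPn h2].
  apply/asboolP; split=> // g cg; rewrite leNgt; apply/negP => h3.
  by apply: h2; exists g.
(* The new radius: [s.+1] offsets the number of characters, [k] the number of sets, and
   [eps ^+ 3 / 2 ^+ 20] makes the smoothing errors small against the gain. *)
pose q (s : nat) := delta * eps ^+ 3 / (2 ^+ 20 * k%:R * s.+1%:R).
have den1 s : 1 <= 2 ^+ 20 * k%:R * s.+1%:R :> R.
  by rewrite mulr_ege1 ?ler1n// mulr_ege1// exprn_ege1// ler1n.
have q0 s : 0 < q s by rewrite divr_gt0 ?mulr_gt0// (lt_le_trans ltr01)// den1.
have qd s : q s <= delta.
  rewrite ler_pdivrMr ?(lt_le_trans ltr01)// ler_wpM2l ?(ltW d0)//.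
  by apply: le_trans (den1 s); rewrite exprn_ile1 ?(ltW e0).
have [hB1|hB1] := lerP (eps / 2 * N) #|B1|%:R.
  exists Rs, delta; split=> //; last by split; [exact: leq_addr|exact: qd].
  have F0 x : 0 <= F x.
    by apply: sumr_ge0 => y _; rewrite mulr_ge0 ?sqr_ge0 ?psi_ge0.
  have hD : eps ^+ 3 / 2 * N <= \sum_x F x.
    apply: (@le_trans _ _ (eps ^+ 2 * #|B1|%:R)).
      by rewrite exprSr -2!mulrA ler_wpM2l ?sqr_ge0// mulrA.
    by apply: sum_ge_card => // x; rewrite inE => /ltW.
  exact: gain_uniform N0 (ltW e30) loss (energy_gain cR (fun g h => h) t0 d0 hD).
have hB2 : eps / 2 * N <= #|B2|%:R.
  by move: bad hB1; move: (#|B1|%:R : R) (#|B2|%:R : R) N => *; lra.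
have hcov x : x \in B2 -> exists2 g, is_character g &
    eps < cmod (local_coef (indic R (A i)) Rs delta x g).
  by rewrite inE => /asboolP.
have [Rs' [uR' cR' sub sz hRs']] :=
  covering_characters (indic01 (A i)) cR d0 e0 hcov.
pose eta' := q (size Rs'); have t0' : 0 < eta' := q0 _.
exists Rs', eta'; split=> //.
  by rewrite t0' (le_trans (qd _) d1).
pose w := (size Rs')%:R * eta' / delta.
have w0 : 0 <= w.
  by apply: divr_ge0; [apply: mulr_ge0; [exact: ler0n|exact: ltW]|exact: ltW].
have p14 : 128 * 128 <= 2 ^+ 20 :> R.
  apply: (@le_trans _ _ (2 ^+ 14)); last by rewrite ler_weXn2l ?ler1n.
  by rewrite (exprD 2 7 7) -natrX -!natrM ler_nat.
have kw : k%:R * w * (128 * 128) <= eps ^+ 3.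
  have -> : k%:R * w = eps ^+ 3 * ((size Rs')%:R / (size Rs').+1%:R) / 2 ^+ 20.
    rewrite /w /eta' /q; have : 0 < (size Rs').+1%:R :> R by rewrite ltr0n.
    have : 0 < 2 ^+ 20 :> R by rewrite exprn_gt0.
    move: (2 ^+ 20) ((size Rs').+1%:R : R) ((size Rs')%:R : R) (k%:R : R) kR => c s1 s k' kR' c0 s10.
    by field; rewrite !gt_eqF.
  have r1 : (size Rs')%:R / (size Rs').+1%:R <= 1 :> R.
    by rewrite ler_pdivrMr ?ltr0n// mul1r ler_nat.
  have r0 : 0 <= (size Rs')%:R / (size Rs').+1%:R :> R by rewrite divr_ge0.
  have c0 : 0 < 2 ^+ 20 :> R by rewrite exprn_gt0.
  move: (_ / (size Rs').+1%:R) (2 ^+ 20) c0 p14 r0 r1 => r c c0 p14 r0 r1.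
  have er : eps ^+ 3 * r <= eps ^+ 3 by apply: ler_piMr; first exact: ltW.
  have y0 : 0 <= eps ^+ 3 * r / c.
    by apply: divr_ge0; [apply: mulr_ge0; [exact: ltW|exact: r0]|exact: ltW].
  apply: le_trans (ler_wpM2l y0 p14) _; rewrite divfK; first exact: er.
  by rewrite gt_eqF.
have wk : w <= k%:R * w by rewrite ler_peMl.
have e31 : eps ^+ 3 <= eps by rewrite exprS ler_piMr ?(ltW e0)// exprn_ile1 ?(ltW e0).
have loss' : 2 * k%:R * (96 * (size Rs')%:R * eta' / delta) <= eps ^+ 3 / 64.
  have -> : 2 * k%:R * (96 * (size Rs')%:R * eta' / delta) = 192 * (k%:R * w).
    rewrite /w; move: (delta^-1) => v; ring.
  exact: loss_arith (ltW e30) kw.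
pose F2 x := \sum_y (conv (indic R (A i)) (psi Rs' eta') (x + y)
  - conv (indic R (A i)) (psi Rs delta) x) ^+ 2 * psi Rs delta y.
have F20 x : 0 <= F2 x.
  by apply: sumr_ge0 => y _; rewrite mulr_ge0 ?sqr_ge0 ?psi_ge0.
(* After smoothing, a coefficient of size [3 / 4 * eps] still exceeds [eps / 2]; Cauchy-Schwarz
   converts it into variance. *)
have hF2 x : x \in B2 -> (eps / 2) ^+ 2 <= F2 x.
  move=> /hRs'[g gR' big].
  have ug n := character_unimod n (cR' _ gR').
  apply: le_trans (cmod_mean_sqr (psi_ge0 Rs d0) (sum_psi Rs d0) _ ug).
  have h2 := psi_coef_smooth x (indic01 (A i)) cR' sub gR' d01 t0'.
  rewrite -/w in h2; rewrite lerXn2r ?nnegrE ?cmod_ge0 ?divr_ge0 ?(ltW e0)//.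
  exact: coef_arith (ltW e0) (le_trans big h2) wk kw e31.
have hD : eps ^+ 3 / 8 * N <= \sum_x F2 x.
  apply: le_trans (sum_ge_card F20 hF2).
  have -> : eps ^+ 3 / 8 * N = (eps / 2) ^+ 2 * (eps / 2 * N) by field.
  by rewrite ler_wpM2l ?sqr_ge0.
(* The Fourier gain starts from radius [delta], so the move from [eta] to [delta] is charged as an
   increment with [D = 0]. *)
have hD0 : 0 <= \sum_x F x.
  by do 2!apply: sumr_ge0 => ? _; rewrite mulr_ge0 ?sqr_ge0 ?psi_ge0.
exact: gain_fourier N0 (ltW e30) loss loss'
  (energy_gain cR (fun g h => h) t0 d0 hD0) (energy_gain cR' sub d0 t0' hD).
Qed.

End Increment.
End Family.
End Step.

(** * Tower bounds and iteration *)

Section Growth.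
Local Open Scope nat_scope.

Lemma ltn_tower h : h < tower h.
Proof. by elim: h => //= h IH; apply: leq_ltn_trans IH _; rewrite ltn_expl. Qed.

Lemma tower_leS h : tower h <= tower h.+1.
Proof. by rewrite /= ltnW// ltn_expl. Qed.

Lemma leq_tower h h' : h <= h' -> tower h <= tower h'.
Proof.
by move=> /subnK <-; elim: (h' - h) => // n IH; apply: leq_trans IH (tower_leS _).
Qed.

Lemma mul4_le_exp2 x : 4 <= x -> 4 * x <= 2 ^ x.
Proof.
elim: x => // x IH; rewrite leq_eqVlt => /orP[/eqP<-//|x4].
by have {}IH := IH x4; rewrite expnS; lia.
Qed.

Lemma exp4_le_exp2_exp2 x : 4 <= x -> x ^ 4 <= 2 ^ 2 ^ x.
Proof.
move=> x4; apply: leq_trans (_ : (2 ^ x) ^ 4 <= _); first by rewrite leq_exp2r// ltnW// ltn_expl.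
by rewrite -expnM leq_exp2l// mulnC mul4_le_exp2.
Qed.

Lemma leq_exp_base m n e : m <= n -> m ^ e <= n ^ e.
Proof. by case: e => // e; rewrite leq_exp2r. Qed.

(** Here [x ^ (20 * x) <= 2 ^ (x ^ 3)], and [x ^ 3] is below a double exponential. Three
    exponentials thus pay for the new characters. *)
Lemma exp20_le x : 20 <= x -> x ^ (20 * x) <= 2 ^ 2 ^ 2 ^ x.
Proof.
move=> x20; have x0 : 0 < x := ltn_trans (isT : 0 < 19) x20.
have x4 : 4 <= x := leq_trans (isT : 4 <= 20) x20.
apply: (@leq_trans (x ^ (x * x))).
  by apply: leq_pexp2l => //; rewrite leq_mul2r x20 orbT.
apply: (@leq_trans ((2 ^ x) ^ (x * x))).
  by apply: leq_exp_base; exact/ltnW/ltn_expl.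
rewrite -expnM leq_exp2l//; apply: leq_trans (exp4_le_exp2_exp2 x4).
by rewrite -[x * (x * x)]/(x ^ 3) leq_pexp2l.
Qed.

Lemma size_growth x d M : 2 ^ 10 <= x -> d <= x -> M <= x ^ 18 ->
  d + M.+1 ^ d <= x ^ (20 * x).
Proof.
move=> x10 dx Mx; have x2 : 2 <= x by apply: leq_trans x10.
have x0 : 0 < x by lia.
have M19 : M.+1 <= x ^ 19.
  rewrite expnS; apply: (@leq_trans (2 * x ^ 18)); last by rewrite leq_mul2r x2 orbT.
  by rewrite mul2n -addnn -addn1 leq_add// expn_gt0 x0.
have h1 : M.+1 ^ d <= x ^ (19 * x).
  apply: leq_trans (_ : (x ^ 19) ^ d <= _); last first.
    by rewrite -expnM leq_pexp2l// leq_mul2l dx orbT.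
  by case: d {dx} => // d; rewrite leq_exp2r.
apply: leq_trans (_ : x ^ (19 * x) + x ^ (19 * x) <= _).
  apply: leq_add => //; apply: leq_trans dx _.
  by rewrite -{1}[x]expn1 leq_pexp2l// muln_gt0.
rewrite addnn -mul2n; apply: leq_trans (_ : x * x ^ (19 * x) <= _).
  by rewrite leq_mul2r x2 orbT.
by rewrite -expnS leq_pexp2l//; lia.
Qed.

(** Since [x ^ 22 <= z], the product is at most [z ^ 4]. Two more exponentials pay for the
    radius. *)
Lemma width_growth x z : 2 ^ 10 <= x -> x ^ (20 * x) <= z -> x ^ 22 * z.+1 <= 2 ^ 2 ^ z.
Proof.
move=> x10 xz; have x2 : 2 <= x by apply: leq_trans x10.
have x0 : 0 < x by lia.
have h1 : x ^ 22 <= z by apply: leq_trans xz; rewrite leq_pexp2l//; lia.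
have z4 : 4 <= z.
  by apply: leq_trans h1; rewrite (@leq_trans (2 ^ 22))// ?leq_exp2r// (@leq_exp2l 2 2).
apply: leq_trans (exp4_le_exp2_exp2 z4).
apply: (@leq_trans (z * z ^ 2)).
  apply: leq_mul => //; apply: (@leq_trans (2 * z)); first by lia.
  by rewrite -[z ^ 2]/(z * z) leq_mul2r; lia.
by rewrite -expnS leq_pexp2l//; lia.
Qed.
End Growth.

(** * Cost of one step in powers of the current tower value [X] *)

Section Bounds.
Variables (R : realType) (G : finZmodType) (k X : nat) (eps : R).
Hypotheses (e0 : 0 < eps) (X10 : (2 ^ 10 <= X)%N)
  (kX : (k <= X)%N) (eX : eps^-1 <= X%:R).
Let XR0 : 0 < X%:R :> R.
Proof. by rewrite ltr0n (leq_trans _ X10). Qed.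
Let XR10 : 2 ^+ 10 <= X%:R :> R.
Proof. by rewrite -natrX ler_nat. Qed.
Let XR1 : 1 <= X%:R :> R.
Proof. by rewrite ler1n -(ltr0n R). Qed.

(** The exponent is [16 = 1 + 4 + 4 + 6 + 1], for [size Rs], [k ^+ 4], [2 ^+ 40], [eps ^- 6] and
    [eta^-1]. *)
Lemma eta2_inv (Rs : seq {ffun G -> R[i]}) eta : 0 < eta ->
  (size Rs <= X)%N -> eta^-1 <= X%:R -> (eta2 k eps Rs eta)^-1 <= X%:R ^+ 16.
Proof.
move=> t0 dX tX; rewrite /eta2; case: ifPn => [_|d0].
  by apply: le_trans tX _; rewrite -[leLHS]expr1 ler_weXn2l.
have ti : 0 <= eta^-1 by rewrite invr_ge0 ltW.
have ei : 0 <= eps^-1 by rewrite invr_ge0 ltW.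
rewrite invf_div (invfM _ eta) (invfM _ (eps ^+ 6)) invrK -exprVn.
have -> : X%:R ^+ 16 = X%:R * X%:R ^+ 4 * (X%:R ^+ 4 * X%:R ^+ 6 * X%:R) :> R.
  by ring.
have h40 : 2 ^+ 40 <= X%:R ^+ 4 :> R.
  by rewrite (exprM 2 10 4) lerXn2r ?nnegrE ?exprn_ge0 ?(ltW XR0).
apply: ler_pM; rewrite ?mulr_ge0 ?exprn_ge0 ?ler0n//.
  by apply: ler_pM; rewrite ?exprn_ge0 ?ler_nat// lerXn2r ?nnegrE ?ler_nat.
apply: ler_pM; rewrite ?mulr_ge0 ?exprn_ge0//.
apply: ler_pM; rewrite ?exprn_ge0//.
by rewrite lerXn2r ?nnegrE ?(ltW XR0).
Qed.

Lemma trunc_growth delta : 0 < delta -> delta^-1 <= X%:R ^+ 16 ->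
  (Num.trunc (16 / (eps * delta)) <= X ^ 18)%N.
Proof.
move=> d0 dX; rewrite -(ler_nat R).
apply: le_trans (_ : 16 / (eps * delta) <= _).
  by rewrite truncn_le divr_ge0 ?mulr_ge0 ?ltW.
have ei : 0 <= eps^-1 by rewrite invr_ge0 ltW.
have di : 0 <= delta^-1 by rewrite invr_ge0 ltW.
rewrite natrX invfM (exprD _ 2 16) expr2 mulrA; apply: ler_pM => //.
  by rewrite mulr_ge0.
by apply: ler_pM => //; rewrite ler_nat; apply: leq_trans X10.
Qed.

(** The powers of [X] are [22 = 2 + 1 + 16 + 3], for [2 ^+ 20], [k], [delta^-1] and [eps ^- 3]. *)
Lemma width_inv delta (d' Z : nat) : 0 < delta -> delta^-1 <= X%:R ^+ 16 ->
  (d' <= Z)%N -> (X ^ (20 * X) <= Z)%N ->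
  (delta * eps ^+ 3 / (2 ^+ 20 * k%:R * d'.+1%:R))^-1 <= (2 ^ 2 ^ Z)%:R.
Proof.
move=> d0 dX dZ XZ.
apply: (@le_trans _ _ ((X ^ 22 * Z.+1)%:R)); last by rewrite ler_nat width_growth.
have ei : 0 <= eps^-1 by rewrite invr_ge0 ltW.
have di : 0 <= delta^-1 by rewrite invr_ge0 ltW.
rewrite invf_div (invfM delta) -exprVn natrM natrX.
have -> : X%:R ^+ 22 * Z.+1%:R
   = X%:R ^+ 2 * X%:R * Z.+1%:R * (X%:R ^+ 16 * X%:R ^+ 3) :> R by ring.
have h20 : 2 ^+ 20 <= X%:R ^+ 2 :> R.
  by rewrite (exprM 2 10 2) lerXn2r ?nnegrE ?exprn_ge0 ?(ltW XR0).
have kXR : k%:R <= X%:R :> R by rewrite ler_nat.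
have dZR : d'.+1%:R <= Z.+1%:R :> R by rewrite ler_nat.
have e3 : eps^-1 ^+ 3 <= X%:R ^+ 3 by rewrite lerXn2r ?nnegrE ?(ltW XR0).
have p20 : 0 <= 2 ^+ 20 :> R by rewrite exprn_ge0.
have e30 : 0 <= eps^-1 ^+ 3 by rewrite exprn_ge0.
apply: ler_pM; [by rewrite !mulr_ge0|by rewrite mulr_ge0| |exact: ler_pM].
by apply: ler_pM => //; exact: ler_pM.
Qed.

End Bounds.

(** * Iterating the energy increment *)

Section Iteration.
Variables (R : realType) (G : finZmodType) (k : nat) (eps : R) (A : 'I_k -> {set G}).
Hypotheses (k0 : (0 < k)%N) (e0 : 0 < eps) (e1 : eps <= 1).

Definition tower_bounded (h : nat) (Rs : seq {ffun G -> R[i]}) (eta : R) :=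
  [/\ uniq Rs, chars Rs, 0 < eta <= 1, (size Rs <= tower h)%N &
      eta^-1 <= (tower h)%:R].

Lemma tower_bounded_le h h' Rs eta : (h <= h')%N ->
  tower_bounded h Rs eta -> tower_bounded h' Rs eta.
Proof.
move=> /leq_tower hh [uR cR t01 sR tR]; split=> //; first exact: leq_trans hh.
by apply: le_trans tR _; rewrite ler_nat.
Qed.

Lemma tower_bounded_step h Rs eta : (2 ^ 10 <= tower h)%N -> (k <= tower h)%N ->
  eps^-1 <= (tower h)%:R -> tower_bounded h Rs eta ->
  ~ (forall i, regular_pair k eps (A i) Rs eta) ->
  exists (Rs' : seq {ffun G -> R[i]}) eta', tower_bounded (h + 5) Rs' eta' /\
    energy A Rs eta + eps ^+ 3 / 16 * #|G|%:R <= energy A Rs' eta'.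
Proof.
move=> X10 kX eX [uR cR t01 sR tR] nreg.
have [Rs' [eta' [uR' cR' t01' gain [sz wd]]]] := energy_step k0 e0 e1 uR cR t01 nreg.
exists Rs', eta'; split=> //.
have /andP[t0 _] := t01; have /andP[d0 _] := eta2_bounds k0 e0 e1 Rs t01.
have /andP[t0' _] := t01'.
have dX := eta2_inv e0 X10 kX eX t0 sR tR.
have size' := leq_trans sz (size_growth X10 sR (trunc_growth e0 X10 eX d0 dX)).
have X20 : (tower h ^ (20 * tower h) <= tower (h + 3))%N.
  by rewrite addn3; apply: exp20_le; apply: leq_trans X10.
have sizeZ := leq_trans size' X20.
split=> //; first by apply: leq_trans sizeZ (leq_tower _); rewrite leq_add2l.
have := width_inv e0 X10 kX eX d0 dX sizeZ X20.
rewrite (_ : h + 5 = (h + 3).+2)%N ?addnS//; apply: le_trans.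
rewrite lef_pV2 ?posrE//; apply: divr_gt0; first by rewrite mulr_gt0 ?exprn_gt0.
by rewrite !mulr_gt0 ?exprn_gt0 ?ltr0n.
Qed.

(** Start from no characters and radius 1. Each failure of regularity costs five tower levels and
    adds one energy quantum; once regular, the pair is kept. *)
Lemma regular_or_energy h0 n : (2 ^ 10 <= tower h0)%N -> (k <= tower h0)%N ->
  eps^-1 <= (tower h0)%:R ->
  exists (Rs : seq {ffun G -> R[i]}) eta, tower_bounded (h0 + 5 * n) Rs eta /\
    ((forall i, regular_pair k eps (A i) Rs eta) \/
     n%:R * (eps ^+ 3 / 16) * #|G|%:R <= energy A Rs eta).
Proof.
move=> X10 kX eX; have h0n m : (h0 + 5 * m <= h0 + 5 * m.+1)%N by lia.
elim: n => [|n [Rs [eta [bd [reg|en]]]]].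
- exists [::], 1; split; last by right; rewrite !mul0r energy_ge0.
  split=> //; first by rewrite ltr01 lexx.
  by rewrite invr1 ler1n; exact: leq_trans (ltn_tower _).
- by exists Rs, eta; split; [exact: tower_bounded_le (h0n n) bd|left].
have hh : (tower h0 <= tower (h0 + 5 * n))%N by apply: leq_tower; exact: leq_addr.
have [reg|nreg] := pselect (forall i, regular_pair k eps (A i) Rs eta).
  by exists Rs, eta; split; [exact: tower_bounded_le (h0n n) bd|left].
have eX' : eps^-1 <= (tower (h0 + 5 * n))%:R by apply: le_trans eX _; rewrite ler_nat.
have [Rs' [eta' [bd' gain]]] :=
  tower_bounded_step (leq_trans X10 hh) (leq_trans kX hh) eX' bd nreg.
exists Rs', eta'; split; first by rewrite mulnSr addnA.
right; apply: le_trans gain; rewrite -natr1 !mulrDl mul1r lerD2r//.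
Qed.

End Iteration.

(** * Choice of the starting height and the number of steps *)

Theorem theorem5p3 (R : realType) (G : finZmodType) (k : nat) (eps : R)
    (A : 'I_k -> {set G}) :
  (0 < k)%N -> 0 < eps ->
  exists (Rs : seq {ffun G -> R[i]}) (eta : R),
    uniq Rs /\
    (forall g, g \in Rs -> is_character g) /\
    (size Rs)%:R <= W (2 ^+ 11 * k%:R ^+ 2 / eps ^+ 3) /\
    0 < eta <= 1 /\
    (W (2 ^+ 11 * k%:R ^+ 2 / eps ^+ 3))^-1 <= eta /\
    (forall i : 'I_k, regular_pair k eps (A i) Rs eta).
Proof.
move=> k0 e0; set t := _ / eps ^+ 3.
have N0 : 0 < #|G|%:R :> R by rewrite ltr0n; apply/card_gt0P; exists 0.
have W1 : 1 <= W t by rewrite ler1n; exact: leq_trans (ltn_tower _).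
(* For [eps > 1] any pair is regular, as at most [N < eps * N] points can fail. *)
have [e1|e1] := lerP eps 1; last first.
  exists [::], 1; split=> //; split=> //; split; first exact: le_trans W1.
  split; first by rewrite ltr01 lexx.
  split=> [|i]; first by rewrite invf_le1// (lt_le_trans ltr01).
  rewrite /regular_pair; apply: (@le_lt_trans _ _ #|G|%:R); last by rewrite ltr_pMl.
  by rewrite ler_nat max_card.
pose u := k%:R ^+ 2 / eps ^+ 3.
have kR1 : 1 <= k%:R :> R by rewrite ler1n.
have e30 : 0 < eps ^+ 3 by rewrite exprn_gt0.
have ei3 : 1 <= (eps ^+ 3)^-1 by rewrite invf_ge1// exprn_ile1// ltW.
have u1 : 1 <= u by rewrite mulr_ege1// exprn_ege1.
have ku : k%:R <= u.
  by rewrite -[leLHS]mulr1; apply: ler_pM => //; rewrite expr2 ler_peMr.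
have eu : eps^-1 <= u.
  apply: (@le_trans _ _ (eps ^+ 3)^-1).
    rewrite lef_pV2 ?posrE// exprS; apply: ler_piMr; first exact: ltW.
    by rewrite exprn_ile1// ltW.
  by rewrite /u ler_peMl ?exprn_ege1// invr_ge0 ltW.
have ku3 : k%:R / eps ^+ 3 <= u by rewrite ler_pM2r ?invr_gt0// expr2 ler_peMr.
(* The starting tower must exceed [k], [eps^-1] and [2 ^ 10]; the summand 11 is 10 for the last
   exponent plus one level for the power. *)
pose m := Num.trunc eps^-1; pose h0 := (k + m.+1 + 11)%N.
(* The successor makes [n] quanta of energy strictly exceed the maximum [k * N]. *)
pose n := (Num.trunc (16 * (k%:R / eps ^+ 3))).+1.
have ei0 : 0 <= eps^-1 by rewrite invr_ge0 ltW.
have /andP[m1 m2] := truncn_itv ei0; rewrite -/m in m1 m2.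
have v0 : 0 <= 16 * (k%:R / eps ^+ 3) by rewrite mulr_ge0// divr_ge0 ?ler0n ?ltW.
have /andP[n1 n2] := truncn_itv v0.
have h0t : (h0 <= tower h0)%N := ltnW (ltn_tower h0).
have X10 : (2 ^ 10 <= tower h0)%N.
  by rewrite /h0 addnS /= leq_exp2l//; apply: leq_trans (ltnW (ltn_tower _)); rewrite leq_addl.
have kX : (k <= tower h0)%N by apply: leq_trans h0t; rewrite /h0 -addnA leq_addr.
have eX : eps^-1 <= (tower h0)%:R.
  apply: le_trans (ltW m2) _; rewrite ler_nat; apply: leq_trans h0t.
  by rewrite /h0 addnAC leq_addl.
have height : (h0 + 5 * n <= `|Num.ceil t|)%N.
  have hr : (h0 + 5 * n)%:R <= t.
    have -> : t = 2 ^+ 11 * u by rewrite /t -mulrA.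
    (* As [k], [m], [k / eps ^+ 3] and 1 are at most [u], [h0] is at most [14 * u] and [5 * n] at
       most [85 * u]. *)
    apply: (@le_trans _ _ (110 * u)).
      rewrite natrD /h0 !natrD natrM -(natr1 m) /n -(natr1 (Num.trunc _)).
      by move: (m%:R : R) ((Num.trunc _)%:R : R) m1 n1 => *; lra.
    by rewrite ler_pM2r ?(lt_le_trans ltr01)// -natrX ler_nat.
  have t0 : 0 <= t by apply: le_trans hr; exact: ler0n.
  rewrite -lez_nat gez0_abs ?ceil_ge0 ?(lt_le_trans _ t0) ?ltrN10//.
  by rewrite -(ler_int R) (le_trans hr)// ceil_ge.
have [Rs [eta [[uR cR t01 sR tR] reg]]] := @regular_or_energy R G k eps A k0 e0 e1 h0 n X10 kX eX.
have tW : ((tower (h0 + 5 * n))%:R <= W t) by rewrite ler_nat leq_tower.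
have /andP[t0 _] := t01.
exists Rs, eta; split=> //; split=> //.
split; first by apply: le_trans tW; rewrite ler_nat.
split=> //; split.
  have Wpos : 0 < W t by exact: lt_le_trans W1.
  by rewrite -[leRHS]invrK lef_pV2 ?posrE ?invr_gt0//; exact: le_trans tW.
case: reg => // en.
have := le_trans en (total_energy_le A Rs t0); rewrite ler_pM2r// leNgt.
suff -> : k%:R < n%:R * (eps ^+ 3 / 16) by [].
rewrite mulrA ltr_pdivlMr// -ltr_pdivrMr//.
by rewrite [k%:R * 16]mulrC -mulrA; exact: n2.
Qed.
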